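(* For every integer $d\ge1$ and all parameters $0<\mu\le L<\infty$, $\sigma^2\ge0$, $0<\varepsilon\le1/10$, putting $\kappa=L/\mu$, $X=\frac{\sigma^2}{\mu\varepsilon}$ and $S=1+\log(1+\kappa)+X$, $$N^\star_{\mathrm{TV}}(d,L,\mu,\sigma,\varepsilon)\ \ge\ \max\{1,\ X/24,\ S/62\}.$$ (The class of algorithms in the definition of $N^\star_{\mathrm{TV}}$ permits arbitrary adaptive full-vector queries and random stopping, with worst-case expected query count.)
   Context: Norms are Euclidean and logarithms natural. For $0<\mu\le L<\infty$, $\mathcal C_d(L,\mu)$ is the set of all $f\in C^1(\mathbb R^d)$ with $\frac\mu2\|x-y\|^2\le f(x)-f(y)-\langle\nabla f(y),x-y\rangle\le\frac L2\|x-y\|^2$ for all $x,y\in\mathbb R^d$, and whose unique minimizer $x_f^\star$ satisfies $\|x_f^\star\|\le\mu^{-1/2}$. The target is $\nu_f(dx)=Z_f^{-1}e^{-f(x)}dx$, $Z_f=\int_{\mathbb R^d}e^{-f}$. $\|P-Q\|_{\mathrm{TV}}=\sup_D|P(D)-Q(D)|$. Oracle and algorithms. An algorithm is a measurable randomized procedure whose rules depend only on the public parameters $d,L,\mu,\sigma^2,\varepsilon$ (not on $f$ or the oracle). It makes sequential queries: at the $t$-th query it selects $x_t\in\mathbb R^d$ from previous queries, replies and internal randomness, and receives a vector $g_t\in\mathbb R^d$. Let $\mathcal H_t^{\rm in}$ be the complete information $\sigma$-field after $x_t$ is selected and immediately before the reply is generated: it contains $x_t$, all previous queries and replies, and all internal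 randomness already generated, but no future random draws. Replies are generated by measurable conditional kernels that may depend on the whole history; the oracle $\mathcal O$ is admissible with variance ceiling $\sigma^2$ if almost surely $\mathbb E[g_t\mid\mathcal H_t^{\rm in}]=\nabla f(x_t)$ and $\mathbb E[\|g_t-\nabla f(x_t)\|^2\mid\mathcal H_t^{\rm in}]\le\sigma^2$. No other information on $f$ is available; exact real arithmetic and internal random generation are free. The number of queries $T$ must be a stopping time for the physical filtration $\mathcal F_t=\sigma(x_1,g_1,\dots,x_t,g_t)$, $\mathcal F_0=\{\varnothing,\Omega\}$; the output may additionally use private randomness. The minimax cost is $N^\star_{\mathrm{TV}}(d,L,\mu,\sigma,\varepsilon)=\inf_{\mathcal A}\sup_{f\in\mathcal C_d(L,\mu),\,\mathcal O}\mathbb E_{f,\mathcal O,\mathcal A}[T]$, the infimum being over measurable, almost surely terminating algorithms obeying these rules whose output law is within TV distance $\varepsilon$ of $\nu_f$ for every $f\in\mathcal C_d(L,\mu)$ and every admissible oracle $\mathcal O$; the infimum of the empty set is $+\infty$. *)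

(* Defs.v *)
From HB Require Import structures.
From mathcomp Require Import all_boot all_order all_algebra.
From mathcomp Require Import all_classical all_reals all_analysis.

Set Implicit Arguments.
Unset Strict Implicit.
Unset Printing Implicit Defensive.

Import Order.TTheory GRing.Theory Num.Theory.
Import numFieldNormedType.Exports.

Local Open Scope classical_set_scope.
Local Open Scope ring_scope.

(* Row vectors carry the sigma-algebra generated by the coordinates; over the
   Borel reals this is the Borel sigma-algebra of 'rV[R]_n. *)
Definition rV_display : measure_display -> measure_display.
Proof. exact. Qed.

Section measurable_rV.
Context {disp : measure_display} {T : measurableType disp}.
Variable n : nat.

Let coord (i : 'I_n) (v : 'rV[T]_n) : T := v ord0 i.

Let rV_set0 : g_sigma_preimage coord set0.
Proof. exact: sigma_algebra0. Qed.

Let rV_setC A : g_sigma_preimage coord A -> g_sigma_preimage coord (~` A).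
Proof. exact: sigma_algebraC. Qed.

Let rV_bigcup (F : _^nat) : (forall i, g_sigma_preimage coord (F i)) ->
  g_sigma_preimage coord (\bigcup_i (F i)).
Proof. exact: sigma_algebra_bigcup. Qed.

HB.instance Definition _ := @isMeasurable.Build (rV_display disp)
  'rV[T]_n (g_sigma_preimage coord) rV_set0 rV_setC rV_bigcup.

End measurable_rV.

Lemma measurable_coord disp (T : measurableType disp) n (i : 'I_n) :
  measurable_fun [set: 'rV[T]_n] (fun v => v ord0 i).
Proof.
move=> _ Y mY; rewrite setTI; apply: sub_sigma_algebra => /=.
rewrite -bigcup_seq/=; exists i => /=; first by rewrite mem_index_enum.
by exists Y => //; rewrite setTI.
Qed.

Lemma measurable_fun_rV d1 d2 (T1 : measurableType d1) (T2 : measurableType d2)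
    n (f : T1 -> 'rV[T2]_n) :
  (forall i, measurable_fun [set: T1] (fun t => f t ord0 i)) ->
  measurable_fun [set: T1] f.
Proof.
move=> mf _ Y mY; rewrite setTI.
suff : measurable `<=` [set B | measurable (f @^-1` B)] by exact.
apply: smallest_sub.
  split => /=.
  - by rewrite preimage_set0.
  - by move=> A mA; rewrite setTD -preimage_setC; exact: measurableC.
  - by move=> F mF; rewrite preimage_bigcup; exact: bigcup_measurable.
move=> B; rewrite -bigcup_seq/= => -[i _ [C mC <-]] /=; rewrite setTI.
by rewrite -[X in measurable X]setTI; exact: mf.
Qed.

Section lebesgue_rV.
Variable R : realType.

Definition cons_rV n (z : measurableTypeR R * 'rV[R]_n) : 'rV[R]_n.+1 :=
  \row_i if unlift ord0 i is Some j then z.2 ord0 j else z.1.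

Lemma measurable_cons_rV n : measurable_fun setT (@cons_rV n).
Proof.
apply: measurable_fun_rV => i; rewrite /cons_rV.
case: (unliftP ord0 i) => [j ->|->].
  rewrite (_ : (fun _ => _) = (fun v : 'rV[R]_n => v ord0 j) \o snd).
    by apply: measurableT_comp; [exact: measurable_coord|].
  by apply/funext => z; rewrite mxE liftK.
rewrite (_ : (fun _ => _) = fst) //; apply/funext => z.
by rewrite mxE unlift_none.
Qed.

Section lebesgue_cons.
Variables (n : nat) (mu : {sigma_finite_measure set 'rV[R]_n -> \bar R}).

Definition lebesgue_cons : set 'rV[R]_n.+1 -> \bar R :=
  pushforward (lebesgue_measure \x mu)%E (@cons_rV n).

Let lebesgue_cons0 : lebesgue_cons set0 = 0%E.
Proof. by rewrite /lebesgue_cons /pushforward preimage_set0 measure0. Qed.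

Let lebesgue_cons_ge0 A : (0 <= lebesgue_cons A)%E.
Proof. by rewrite /lebesgue_cons /pushforward measure_ge0. Qed.

Let lebesgue_cons_sigma_additive : semi_sigma_additive lebesgue_cons.
Proof.
move=> F mF tF mUF; rewrite /lebesgue_cons /pushforward preimage_bigcup.
have mc B : measurable B -> measurable (@cons_rV n @^-1` B).
  by move=> mB; rewrite -[X in measurable X]setTI; exact: measurable_cons_rV.
apply: measure_semi_sigma_additive.
- by move=> k; exact: mc.
- apply/trivIsetP => /= i j _ _ ij; rewrite -preimage_setI.
  by move/trivIsetP : tF => /(_ _ _ _ _ ij) ->//; rewrite preimage_set0.
- by rewrite -preimage_bigcup; exact: mc.
Qed.

HB.instance Definition _ := isMeasure.Build _ _ _ lebesgue_cons
  lebesgue_cons0 lebesgue_cons_ge0 lebesgue_cons_sigma_additive.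

Lemma lebesgue_cons_box (A : 'I_n.+1 -> set R) :
  (forall i, measurable (A i)) ->
  (lebesgue_cons [set v : 'rV[R]_n.+1 | forall i, A i (v ord0 i)] =
   lebesgue_measure (A ord0) *
   mu [set v : 'rV[R]_n | forall j : 'I_n, A (lift ord0 j) (v ord0 j)])%E.
Proof.
move=> mA; set B := [set v : 'rV[R]_n | _].
have mB : measurable B.
  rewrite (_ : B = \bigcap_(j in [set: 'I_n])
      (fun v : 'rV[R]_n => v ord0 j) @^-1` A (lift ord0 j)).
    apply: fin_bigcap_measurable => // j _.
    by rewrite -[X in measurable X]setTI; exact: measurable_coord.
  by apply/seteqP; split => [v /= Bv j _|v /= Bv j]; exact: Bv.
rewrite /lebesgue_cons /pushforward -product_measure1E //; last exact: mA.
congr product_measure1; apply/seteqP; split => [[x v]/= Av|[x v]/= [Ax Av] i].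
  split; first by have := Av ord0; rewrite mxE unlift_none.
  by move=> j; have := Av (lift ord0 j); rewrite mxE liftK.
by rewrite mxE; case: unliftP => [j ->|->].
Qed.

Let lebesgue_cons_sigma_finite : sigma_finite setT lebesgue_cons.
Proof.
have /sigma_finiteP[F [TF ndF Foo]] :=
  sigma_finiteT (@lebesgue_measure R : {sigma_finite_measure set _ -> \bar R}).
have /sigma_finiteP[G [TG ndG Goo]] := sigma_finiteT mu.
pose u (v : 'rV[R]_n.+1) : measurableTypeR R * 'rV[R]_n :=
  (v ord0 ord0, \row_j v ord0 (lift ord0 j)).
have mu_ : measurable_fun setT u.
  apply: measurable_fun_pair; first exact: measurable_coord.
  apply: measurable_fun_rV => i; rewrite (_ : (fun _ => _) =
    (fun v : 'rV[R]_n.+1 => v ord0 (lift ord0 i))).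
    exact: measurable_coord.
  by apply/funext => v; rewrite mxE.
have uK z : u (cons_rV z) = z.
  case: z => x v; rewrite /u /cons_rV !mxE unlift_none; congr pair.
  by apply/rowP => j; rewrite !mxE liftK.
exists (fun k => u @^-1` (F k `*` G k)).
  apply/seteqP; split => // v _; have [i _ Fi] : (\bigcup_i F i) (u v).1.
    by rewrite -TF.
  have [j _ Gj] : (\bigcup_i G i) (u v).2 by rewrite -TG.
  exists (maxn i j) => //; split.
    by move: Fi; exact/subsetPset/ndF/leq_maxl.
  by move: Gj; exact/subsetPset/ndG/leq_maxr.
move=> k; have [mF Fk] := Foo k; have [mG Gk] := Goo k; split.
  by rewrite -[X in measurable X]setTI; apply: mu_ => //; exact: measurableX.
rewrite /lebesgue_cons /pushforward (_ : _ @^-1` _ = F k `*` G k); last first.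
  by apply/funext => z; exact: (congr1 (F k `*` G k) (uK z)).
by rewrite product_measure1E// lte_mul_pinfty// ge0_fin_numE.
Qed.

HB.instance Definition _ := Measure_isSigmaFinite.Build _ _ _ lebesgue_cons
  lebesgue_cons_sigma_finite.

End lebesgue_cons.

(* Lebesgue measure on R^n, as an n-fold product; the characterization by boxes
   is [lebesgue_rV_box]. *)
Fixpoint lebesgue_rV n : {sigma_finite_measure set 'rV[R]_n -> \bar R} :=
  if n is n'.+1 then lebesgue_cons (lebesgue_rV n') else \d_(0 : 'rV[R]_0).

Lemma lebesgue_rV_box n (A : 'I_n -> set R) :
  (forall i, measurable (A i)) ->
  (lebesgue_rV n [set v : 'rV[R]_n | forall i, A i (v ord0 i)] =
   \prod_(i < n) lebesgue_measure (A i))%E.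
Proof.
elim: n A => [|n IHn] A mA /=.
  rewrite big_ord0 diracE mem_set //; by case.
by rewrite lebesgue_cons_box // big_ord_recl -IHn.
Qed.

End lebesgue_rV.

(* The joint law of (x, y) when x ~ mu and y ~ k x. *)
Section kjoint.
Context d1 d2 (T1 : measurableType d1) (T2 : measurableType d2) (R : realType).
Variables (mu : probability T1 R) (k : R.-pker T1 ~> T2).
Local Open Scope ereal_scope.

Definition kjoint (A : set (T1 * T2)) : \bar R :=
  \int[mu]_x k x (xsection A x).

Let kjoint0 : kjoint set0 = 0.
Proof. by rewrite /kjoint integral0_eq// => x _; rewrite xsection0. Qed.

Let kjoint_ge0 A : 0 <= kjoint A.
Proof. by apply: integral_ge0 => x _; exact: measure_ge0. Qed.

Let kjoint_sigma_additive : semi_sigma_additive kjoint.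
Proof.
move=> F mF tF mUF.
rewrite [X in _ --> X](_ : _ = \sum_(n <oo) kjoint (F n)).
  by apply/cvg_closeP; split; [exact: is_cvg_nneseries|rewrite closeE].
rewrite /kjoint -integral_nneseries//; last first.
  by move=> n; apply: measurable_fun_xsection_finite_kernel; rewrite inE.
apply: eq_integral => x _; apply/esym/cvg_lim => //=; rewrite xsection_bigcup.
apply: (measure_sigma_additive _ (trivIset_xsection tF)) => n.
exact: measurable_xsection.
Qed.

HB.instance Definition _ := isMeasure.Build _ _ _ kjoint
  kjoint0 kjoint_ge0 kjoint_sigma_additive.

Let kjoint_setT : kjoint setT = 1.
Proof.
rewrite /kjoint (eq_integral (cst 1)) => [|x _].
  by rewrite integral_cst//= probability_setT mule1.
by rewrite [xsection _ _](_ : _ = setT) ?prob_kernel// xsectionE preimage_setT.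
Qed.

HB.instance Definition _ := Measure_isProbability.Build _ _ _ kjoint kjoint_setT.

End kjoint.

Section target.
Context {R : realType} {d : nat}.
Implicit Types (x y : 'rV[R]_d) (f : 'rV[R]_d -> R).

Definition dotrV x y : R := \sum_(i < d) x ord0 i * y ord0 i.

(* The library norm on row vectors is the sup norm. *)
Definition enorm x : R := Num.sqrt (\sum_(i < d) x ord0 i ^+ 2).

Definition gradient f x : 'rV[R]_d := \row_(i < d) 'D_(delta_mx ord0 i) f x.

Definition is_C1 f : Prop :=
  (forall x, differentiable f x) /\ continuous (gradient f).

Definition unique_minimizer f x : Prop :=
  (forall y, f x <= f y) /\ (forall z, (forall y, f z <= f y) -> z = x).

Definition potential_class (L mu : R) f : Prop :=
  [/\ is_C1 f,
      forall x y,
        mu / 2 * enorm (x - y) ^+ 2 <= f x - f y - dotrV (gradient f y) (x - y)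
          <= L / 2 * enorm (x - y) ^+ 2
    & exists2 x, unique_minimizer f x & enorm x <= (Num.sqrt mu)^-1].

Definition partition_function f : \bar R :=
  (\int[lebesgue_rV R d]_x (expR (- f x))%:E)%E.

Definition gibbs f (D : set 'rV[R]_d) : \bar R :=
  ((fine (partition_function f))^-1%:E *
   \int[lebesgue_rV R d]_(x in D) (expR (- f x))%:E)%E.

End target.

Definition tv_dist d (T : measurableType d) (R : realType)
    (P Q : set T -> \bar R) : \bar R :=
  ereal_sup [set `|P D - Q D|%E | D in measurable].

Section model.
Context {R : realType} {d : nat}.
Local Notation V := 'rV[R]_d.

(* A round is a triple ((w, x), g): fresh internal randomness w, query x,
   reply g.  A history lists the past rounds, the most recent one first. *)
Local Notation history W n := (n.-tuple (W * V * V)%type).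

(* The public part of a history, i.e. its queries and replies. *)
Definition transcript W n (h : history W n) : n.-tuple (V * V) :=
  map_tuple (fun r => (r.1.2, r.2)) h.

Section push_round.
Context disp (W : measurableType disp).

Definition push_round n (z : history W n * (W * V) * V) : history W n.+1 :=
  [tuple of (z.1.2, z.2) :: z.1.1].

Lemma measurable_push_round n : measurable_fun setT (@push_round n).
Proof.
apply: measurable_cons; last exact: measurableT_comp.
by apply: measurable_fun_pair => //; exact: measurableT_comp.
Qed.

HB.instance Definition _ n :=
  isMeasurableFun.Build _ _ _ _ (@push_round n) (@measurable_push_round n).

End push_round.

(* [draw n] produces the internal randomness and the query of round n.+1 from
   the first n rounds.  [stop n] decides, from the transcript of the first n
   rounds only, whether to stop after n queries; at n = 0 the transcript is
   empty, so that this decision is deterministic.  [output n] is the conditional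
   law of the answer when exactly n queries were made. *)
Record algorithm := Algorithm {
  rand_display : measure_display;
  rand : measurableType rand_display;
  draw : forall n, R.-pker (history rand n) ~> (rand * V)%type;
  stop : forall n, set (n.-tuple (V * V)%type);
  measurable_stop : forall n, measurable (@stop n);
  output : forall n, R.-pker (history rand n) ~> V }.

Arguments stop : clear implicits.

(* The reply kernel of round n.+1 may use everything generated so far: the first
   n rounds and the current randomness and query. *)
Definition oracle (A : algorithm) : Type :=
  forall n, R.-pker (history (rand A) n * (rand A * V))%type ~> V.

Section run.
Variables (A : algorithm) (orc : oracle A).
Local Notation W := (rand A).

(* The law of the first n rounds.  As for any stopping time, the query process
   itself is infinite; what follows T affects neither T nor the output. *)
Fixpoint law n : probability (history W n) R :=
  if n is n'.+1 then
    distribution (kjoint (kjoint (law n') (draw A n')) (orc n'))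
      (@push_round _ W n')
  else \d_([tuple] : history W 0).

(* The law of all the information available to the oracle at round n.+1. *)
Definition query_law n : probability (history W n * (W * V))%type R :=
  kjoint (law n) (draw A n).

(* No stop before the n-th reply: T >= n. *)
Fixpoint running n : set (n.-tuple (V * V)) :=
  if n is n'.+1 then
    [set t : n'.+1.-tuple (V * V) |
      let t' : n'.-tuple (V * V) := [tuple of behead t] in
      running t' /\ ~ stop A n' t']
  else setT.

(* The event T = n. *)
Definition stops_at n : set (history W n) :=
  [set h | running (transcript h) /\ stop A n (transcript h)].

Definition terminates : Prop :=
  (\sum_(0 <= n <oo) law n (@stops_at n) = 1)%E.

(* E[T]; only used for algorithms that terminate almost surely, so no term for
   T = +oo is needed. *)
Definition expected_queries : \bar R :=
  (\sum_(0 <= n <oo) n%:R%:E * law n (@stops_at n))%E.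

Definition output_law (D : set V) : \bar R :=
  (\sum_(0 <= n <oo) \int[law n]_(h in @stops_at n) output A n h D)%E.

(* Unbiasedness and the variance ceiling, conditionally on the information at
   query time.  The mean being finite, the coordinates of g are integrable. *)
Definition admissible (f : V -> R) (sigma2 : R) : Prop :=
  forall n, {ae query_law n, forall z,
    let x := z.2.2 in
    (forall i, \int[orc n z]_g (g ord0 i)%:E = (gradient f x ord0 i)%:E)%E /\
    (\int[orc n z]_g (enorm (g - gradient f x) ^+ 2)%:E <= sigma2%:E)%E}.

End run.

Section minimax.
Variables (L mu sigma2 eps : R).

Definition valid (A : algorithm) : Prop :=
  forall (f : V -> R) (orc : oracle A), potential_class L mu f ->
    admissible orc f sigma2 ->
    terminates orc /\ (tv_dist (output_law orc) (gibbs f) <= eps%:E)%E.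

Definition worst_case_queries (A : algorithm) : \bar R :=
  ereal_sup [set c | exists f (orc : oracle A),
    [/\ potential_class L mu f, admissible orc f sigma2
      & c = expected_queries orc]].

End minimax.
End model.

Definition minimax_queries (R : realType) (d : nat) (L mu sigma2 eps : R) :
    \bar R :=
  ereal_inf [set c | exists A : @algorithm R d,
    valid L mu sigma2 eps A /\ c = worst_case_queries L mu sigma2 A].

(* Main.v *)
Require Import Defs.
From HB Require Import structures.
From mathcomp Require Import all_boot all_order all_algebra.
From mathcomp Require Import all_classical all_reals all_analysis.
From mathcomp Require Import measurable_realfun ring lra.

(* All hard instances are [x |-> phi (x_0) + mu/2 sum_(j > 0) x_j^2] with [phi] a
   function on the line, so that the target factors and only its first marginal
   matters.

   Noise.  The targets centered at [+b e_0] and [-b e_0], with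
   [b = 5 eps / sqrt mu], are more than [2 eps] apart in total variation.  An
   unbiased oracle may answer as if the center were [0], except with
   probability [p], where it exaggerates the displacement by a factor [1 / p];
   the variance ceiling permits [p] of order [mu eps^2 / sigma2].  The law of a
   run against it dominates [(1 - p)^T] times the law of a run against the exact
   oracle of the centered quadratic, so [E T] is at least of order [eps / p];
   the case [p = 1] shows that no algorithm can stop without a query.

   Condition number.  Adding a Huber term with window of radius
   [w = 8 / sqrt L] around a point [a] concentrates the target on that window,
   while outside of it the gradient only tells on which side [a] lies.  Hence
   one of three replies guessed uniformly is right with probability [1/3], and
   with [3^(r+1)] disjoint windows inside the ball of radius [1 / sqrt mu] an
   algorithm making fewer than [r] queries finds the right one for at most a
   third of the windows. *)

Set Implicit Arguments.
Unset Strict Implicit.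
Unset Printing Implicit Defensive.

Import Order.TTheory GRing.Theory Num.Theory.
Import numFieldNormedType.Exports.

Local Open Scope ring_scope.
Local Open Scope classical_set_scope.

(** * Domination of runs against different oracles *)

Section domination.
Local Open Scope ereal_scope.
Context {R : realType}.

Lemma ge0_integral_dominated disp (T : measurableType disp)
    (m1 m2 : {measure set T -> \bar R}) (c : R) (D : set T)
    (f g : T -> \bar R) :
  (0 <= c)%R ->
  (forall B, measurable B -> c%:E * m1 B <= m2 B) -> measurable D ->
  measurable_fun [set: T] f -> measurable_fun [set: T] g ->
  (forall x, 0 <= f x) -> (forall x, f x <= g x) ->
  c%:E * \int[m1]_(x in D) f x <= \int[m2]_(x in D) g x.
Proof.
move=> c0 m12 mD mf mg f0 fg.
have mfD : measurable_fun D f by exact: measurable_funTS.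
rewrite -[c]/((NngNum c0)%:num) -ge0_integral_mscale//.
apply: (@le_trans _ _ (\int[m2]_(x in D) f x)).
  by apply: ge0_le_measure_integral => // B mB; exact: m12.
by apply: ge0_le_integral => //; exact: measurable_funTS.
Qed.

Lemma kjoint_dominated d1 d2 (T1 : measurableType d1) (T2 : measurableType d2)
    (mu1 mu2 : probability T1 R) (k1 k2 : R.-pker T1 ~> T2) (a b : R) :
  (0 <= a)%R -> (0 <= b)%R ->
  (forall B, measurable B -> a%:E * mu1 B <= mu2 B) ->
  (forall x B, measurable B -> b%:E * k1 x B <= k2 x B) ->
  forall A, measurable A ->
    (a * b)%:E * kjoint mu1 k1 A <= kjoint mu2 k2 A.
Proof.
move=> a0 b0 m12 k12 A mA; rewrite /kjoint EFinM -muleA.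
have mk (k : R.-pker T1 ~> T2) : measurable_fun setT (fun x => k x (xsection A x)).
  by apply: measurable_fun_xsection_finite_kernel; rewrite inE.
rewrite -ge0_integralZl//.
apply: ge0_integral_dominated => //.
- by apply: measurable_funeM; exact: mk.
- by move=> x; rewrite mule_ge0.
- by move=> x; apply: k12; exact: measurable_xsection.
Qed.

End domination.

(** * Runs stopped after a given number of queries, and their comparison *)

Section run_lemmas.
Context {R : realType} {d : nat}.
Local Notation V := 'rV[R]_d.
Implicit Types A : @algorithm R d.
Local Notation stops_at A n := (@Defs.stops_at R d A n).
Local Notation output A n := (@Defs.output R d A n).
Local Notation draw A n := (@Defs.draw R d A n).
Local Notation stop A n := (@Defs.stop R d A n).
Local Notation running A n := (@Defs.running R d A n).
Local Open Scope ereal_scope.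

Lemma measurable_transcript disp (W : measurableType disp) n :
  measurable_fun setT (fun h : n.-tuple (W * V * V) => transcript h).
Proof.
apply/measurable_fun_tnthP => i.
rewrite (_ : _ \o _ = (fun r : W * V * V => (r.1.2, r.2)) \o (@tnth n _ ^~ i)).
  apply: measurableT_comp; last exact: measurable_tnth.
  apply: measurable_fun_pair => //.
  exact: measurableT_comp.
by apply/funext => h /=; rewrite /transcript tnth_map.
Qed.

Lemma measurable_running A n : measurable (running A n).
Proof.
elim: n => [|n IHn] /=; first exact: measurableT.
have mb := @measurable_behead _ (V * V)%type n.
have mpre (B : set (n.-tuple (V * V))) : measurable B ->
    measurable [set t : n.+1.-tuple (V * V) | B [tuple of behead t]].
  by move=> mB; rewrite -[X in measurable X]setTI; exact: mb.
apply: (mpre (running A n `&` ~` stop A n)).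
by apply: measurableI => //; apply: measurableC; exact: measurable_stop.
Qed.

Lemma measurable_stops_at A n : measurable (stops_at A n).
Proof.
rewrite (_ : stops_at A n = setT `&` (fun h => transcript h) @^-1`
    (running A n `&` stop A n)).
  apply: measurable_transcript => //; apply: measurableI.
    exact: measurable_running.
  exact: measurable_stop.
by rewrite setTI.
Qed.

(** The part of [output_law] contributed by runs with [T = n]. It is isolated because the loss in
    comparing two oracles depends on [n]. *)
Definition stop_output A (orc : oracle A) n (D : set V) :=
  \int[law orc n]_(h in stops_at A n) output A n h D.

Lemma stop_output_ge0 A (orc : oracle A) n D : 0 <= stop_output orc n D.
Proof. by apply: integral_ge0 => h _; exact: measure_ge0. Qed.

Lemma output_lawE A (orc : oracle A) D :
  output_law orc D = \sum_(0 <= n <oo) stop_output orc n D.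
Proof. by []. Qed.

Lemma stop_output_setT A (orc : oracle A) n :
  stop_output orc n setT = law orc n (stops_at A n).
Proof.
rewrite /stop_output (eq_integral (cst 1)) => [|h _]; last by rewrite prob_kernel.
by rewrite integral_cst ?mul1e//; exact: measurable_stops_at.
Qed.

Lemma stop_output_bigsetU A (orc : oracle A) n k (D : nat -> set V) :
  (forall i, measurable (D i)) -> trivIset setT D ->
  \sum_(i < k) stop_output orc n (D i) =
  stop_output orc n (\big[setU/set0]_(i < k) D i).
Proof.
move=> mD tD; rewrite /stop_output -ge0_integral_sum//.
- by apply: eq_integral => h _; rewrite measure_bigsetU.
- exact: measurable_stops_at.
- by move=> i; apply: measurable_funTS; exact: measurable_kernel.
Qed.

Lemma stop_output_le A (orc : oracle A) n D : measurable D ->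
  stop_output orc n D <= law orc n (stops_at A n).
Proof.
move=> mD; rewrite -stop_output_setT; apply: ge0_le_integral => //.
- exact: measurable_stops_at.
- by apply: measurable_funTS; exact: measurable_kernel.
- by apply: measurable_funTS; exact: measurable_kernel.
- by move=> h _; apply: le_measure; rewrite ?inE.
Qed.

Lemma stop_outputC A (orc : oracle A) n D : measurable D ->
  stop_output orc n D + stop_output orc n (~` D) =
  law orc n (stops_at A n).
Proof.
move=> mD; rewrite -stop_output_setT -ge0_integralD//.
- apply: eq_integral => h _; rewrite -measureU ?setUv// ?setICr//.
  exact: measurableC.
- exact: measurable_stops_at.
- by apply: measurable_funTS; exact: measurable_kernel.
- by apply: measurable_funTS; apply: measurable_kernel; exact: measurableC.
Qed.

(** Both runs share the kernels [draw], so each round costs one factor [c], coming from its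
    reply. *)
Lemma law_dominated A (orc1 orc2 : oracle A) (c : R) :
  (0 <= c)%R ->
  (forall n z B, measurable B -> c%:E * orc1 n z B <= orc2 n z B) ->
  forall n B, measurable B -> (c ^+ n)%:E * law orc1 n B <= law orc2 n B.
Proof.
move=> c0 c12; elim=> [|n IHn] B mB /=; first by rewrite expr0 mul1e.
have mB' : measurable (@push_round R d _ _ n @^-1` B).
  by rewrite -[X in measurable X]setTI; exact: measurable_push_round.
rewrite exprSr; apply: (@kjoint_dominated R _ _ _ _
  (kjoint (law orc1 n) (draw A n)) (kjoint (law orc2 n) (draw A n))
  (orc1 n) (orc2 n) (c ^+ n) c) => //.
- exact: exprn_ge0.
- move=> C mC /=; rewrite -[(_ ^+ _)%R]mulr1.
  apply: (@kjoint_dominated R _ _ _ _ (law orc1 n) (law orc2 n)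
    (draw A n) (draw A n) (c ^+ n) 1) => //.
  + exact: exprn_ge0.
  + by move=> x D mD; rewrite mul1e.
- exact: c12.
Qed.

Lemma stop_output_dominated A (orc1 orc2 : oracle A) (c : R) :
  (0 <= c)%R ->
  (forall n z B, measurable B -> c%:E * orc1 n z B <= orc2 n z B) ->
  forall n D, measurable D ->
    (c ^+ n)%:E * stop_output orc1 n D <= stop_output orc2 n D.
Proof.
move=> c0 c12 n D mD.
apply: (@ge0_integral_dominated _ _ _ _ _ (c ^+ n)) => //.
- exact: exprn_ge0.
- by move=> B mB; exact: law_dominated.
- exact: measurable_stops_at.
- exact: measurable_kernel.
- exact: measurable_kernel.
Qed.

(** Le Cam's two-point argument with a common minorant. The left side is the expectation of [c ^ T]
    under [orc0]; every stopped run answers in [D], which is charged to [orc1], or outside [D],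
    which is charged to [orc2]. *)
Lemma stopped_mass_le A (orc0 orc1 orc2 : oracle A) (c : R) (D : set V) :
  (0 <= c)%R -> measurable D ->
  (forall n z B, measurable B -> c%:E * orc0 n z B <= orc1 n z B) ->
  (forall n z B, measurable B -> c%:E * orc0 n z B <= orc2 n z B) ->
  \sum_(0 <= n <oo) (c ^+ n)%:E * law orc0 n (stops_at A n) <=
  output_law orc1 D + output_law orc2 (~` D).
Proof.
move=> c0 mD c1 c2; rewrite !output_lawE -nneseriesD; last 2 first.
- by move=> n _ _; exact: stop_output_ge0.
- by move=> n _ _; exact: stop_output_ge0.
apply: lee_nneseries => [n _ _|n _].
  by rewrite mule_ge0// lee_fin exprn_ge0.
rewrite -(stop_outputC orc0 n mD) ge0_muleDr ?stop_output_ge0//.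
apply: leeD; apply: stop_output_dominated => //.
exact: measurableC.
Qed.

(** Markov's inequality: runs with fewer than [r] queries are kept in the sum, and the others have
    total probability at most [E T / r]. *)
Lemma expected_queries_ge A (orc : oracle A) r D : measurable D ->
  r%:R%:E * output_law orc D <=
  r%:R%:E * \sum_(0 <= n < r) stop_output orc n D + expected_queries orc.
Proof.
move=> mD; rewrite output_lawE (nneseries_split 0 r); last first.
  by move=> k _; exact: stop_output_ge0.
rewrite add0n ge0_muleDr; last 2 first.
- by apply: sume_ge0 => k _; exact: stop_output_ge0.
- by apply: nneseries_ge0 => k _ _; exact: stop_output_ge0.
apply: leeD => //; rewrite /expected_queries.
rewrite (nneseries_split 0 r) => [|k _]; last by rewrite mule_ge0// lee_fin.
rewrite add0n -nneseriesZl => [|k _]; last exact: stop_output_ge0.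
rewrite -[leLHS]add0e; apply: leeD.
  by apply: sume_ge0 => k _; rewrite mule_ge0// lee_fin.
rewrite eseries_cond [leRHS]eseries_cond; apply: lee_nneseries => k.
  by move=> _ _; rewrite mule_ge0// ?lee_fin// stop_output_ge0.
move=> rk; apply: lee_pmul; rewrite ?lee_fin ?ler_nat//.
- exact: stop_output_ge0.
- exact: stop_output_le.
Qed.

(** Under the one reference run the disjoint sets [D i] share a mass at most 1 for each number [k]
    of queries. Under their own oracles they are thus hit with total mass at most [3 ^ k], however
    large [K] is. *)
Lemma packing_bound A (orc : nat -> oracle A) (ref : oracle A) (K r : nat)
    (D : nat -> set V) :
  (forall i, measurable (D i)) -> trivIset setT D ->
  (forall i, (i < K)%N -> forall n z B, measurable B ->
    (3%:R^-1)%:E * orc i n z B <= ref n z B) ->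
  r%:R%:E * \sum_(i < K) output_law (orc i) (D i) <=
  (r%:R * 3 ^+ r)%:E + \sum_(i < K) expected_queries (orc i).
Proof.
move=> mD tD dom.
have s0 i k : 0 <= stop_output (orc i) k (D i) by exact: stop_output_ge0.
have o0 i : 0 <= output_law (orc i) (D i).
  by rewrite output_lawE; apply: nneseries_ge0.
rewrite ge0_sume_distrr//.
apply: (@le_trans _ _ (\sum_(i < K) (r%:R%:E *
  \sum_(0 <= n < r) stop_output (orc i) n (D i) + expected_queries (orc i)))).
  by apply: lee_sum => i _; exact: expected_queries_ge.
rewrite big_split/=; apply: leeD => //.
rewrite -ge0_sume_distrr; last by move=> i _; apply: sume_ge0.
rewrite EFinM; apply: lee_pmul => //.
  by apply: sume_ge0 => i _; apply: sume_ge0.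
rewrite exchange_big/=.
have sumr k : \sum_(i < K) stop_output (orc i) k (D i) <= (3 ^+ k)%:E.
  apply: (@le_trans _ _ ((3 ^+ k)%:E * \sum_(i < K) stop_output ref k (D i))).
    rewrite ge0_sume_distrr => [|i _]; last exact: stop_output_ge0.
    apply: lee_sum => i _.
    have -> : stop_output (orc i) k (D i) =
        (3 ^+ k)%:E * ((3^-1 ^+ k)%:E * stop_output (orc i) k (D i)).
      by rewrite muleA -EFinM -exprMn divff ?expr1n ?mul1e.
    apply: lee_wpmul2l; first by rewrite lee_fin exprn_ge0.
    by apply: stop_output_dominated => //; apply: dom.
  rewrite -[leRHS]mule1; apply: lee_wpmul2l; first by rewrite lee_fin exprn_ge0.
  rewrite stop_output_bigsetU//.
  apply: (@le_trans _ _ (law ref k (stops_at A k))).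
    by apply: stop_output_le; exact: bigsetU_measurable.
  by apply: probability_le1; exact: measurable_stops_at.
(* The geometric sum stays below [3 ^ r] because [3 ^ r + 3 ^ r <= 3 ^ r.+1]. *)
elim: r => [|r IHr]; first by rewrite big_geq// lee_fin.
rewrite big_nat_recr//= (le_trans (leeD IHr (sumr r)))//.
by rewrite lee_fin exprS; have : (0 <= 3 ^+ r :> R)%R by []; lra.
Qed.

End run_lemmas.

(** * Mixtures of two kernels *)

Section mixture.
Local Open Scope ereal_scope.
Context d1 d2 (T1 : measurableType d1) (T2 : measurableType d2) (R : realType).
Variables (p : R) (k1 k2 : R.-pker T1 ~> T2).
Hypotheses (p0 : (0 <= p)%R) (p1 : (p <= 1)%R).

Let q0 : (0 <= 1 - p)%R. Proof. by rewrite subr_ge0. Qed.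

Definition kmix (x : T1) : {measure set T2 -> \bar R} :=
  measure_add (mscale (NngNum p0) (k1 x)) (mscale (NngNum q0) (k2 x)).

Lemma kmixE x B : kmix x B = p%:E * k1 x B + (1 - p)%:E * k2 x B.
Proof. exact: measure_addE. Qed.

Let measurable_kmix U : measurable U -> measurable_fun [set: T1] (kmix ^~ U).
Proof.
move=> mU; rewrite (_ : kmix ^~ U =
    (fun x => p%:E * k1 x U + (1 - p)%:E * k2 x U)); last first.
  by apply/funext => x; rewrite kmixE.
by apply: emeasurable_funD; apply: measurable_funeM; exact: measurable_kernel.
Qed.

HB.instance Definition _ := isKernel.Build _ _ _ _ _ kmix measurable_kmix.

Let kmix_setT x : kmix x [set: T2] = 1.
Proof. by rewrite kmixE !prob_kernel !mule1 -EFinD addrC subrK. Qed.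

HB.instance Definition _ := Kernel_isProbability.Build _ _ _ _ _ kmix kmix_setT.

Lemma ge0_integral_kmix x (f : T2 -> \bar R) :
  (forall y, 0 <= f y) -> measurable_fun [set: T2] f ->
  \int[kmix x]_y f y =
  p%:E * \int[k1 x]_y f y + (1 - p)%:E * \int[k2 x]_y f y.
Proof.
by move=> f0 mf; rewrite ge0_integral_measure_add// !ge0_integral_mscale.
Qed.

End mixture.

Lemma integral_kmix_kdirac {R : realType} d1 d2 (T1 : measurableType d1)
    (T2 : measurableType d2) (p : R) (p0 : 0 <= p) (p1 : p <= 1) (u v : T1 -> T2)
    (mu : measurable_fun [set: T1] u) (mv : measurable_fun [set: T1] v)
    x (f : T2 -> R) : measurable_fun [set: T2] f ->
  (\int[kmix (kdirac mu) (kdirac mv) p0 p1 x]_y (f y)%:E =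
   (p * f (u x) + (1 - p) * f (v x))%:E)%E.
Proof.
move=> mf; have mf' : measurable_fun [set: T2] (EFin \o f).
  exact/measurable_EFinP.
rewrite integralE !ge0_integral_kmix//; last 2 first.
- exact: measurable_funeneg.
- exact: measurable_funepos.
rewrite !integral_dirac//; try exact: measurable_funepos; try exact: measurable_funeneg.
rewrite !diracT !mul1e !(funeposE, funenegE) /= -!EFin_max -!EFinM -!EFinD.
(* [f] has no sign, so the integrals of its positive and negative parts were computed separately;
   this identity recombines them. *)
have maxE (a : R) : Num.max a 0 = a + Num.max (- a) 0.
  by rewrite !maxEle oppr_le0; case: (leP a 0); case: (leP 0 a); lra.
by congr EFin; rewrite (maxE (f (u x))) (maxE (f (v x))); ring.
Qed.

(** * Potentials depending nontrivially on the first coordinate *)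

(** The bound leaves the difference quotient within [C |h|] of [c]. Derivatives can thus be read off
    from two-sided quadratic bounds, without differentiating the potentials explicitly. *)
Lemma is_derive_quadratic_remainder {R : realType} {V : normedModType R}
    (f : V -> R) (x v : V) (c C : R) :
  (forall h, `|f (h *: v + x) - f x - h * c| <= C * h ^+ 2) ->
  is_derive x v f c.
Proof.
move=> fC; have cv : (fun h => h^-1 *: ((f \o shift x) (h *: v) - f x)) @ 0^' --> c.
  apply/cvgrPdist_le => e e0; near=> h.
  have h0 : h != 0 by near: h; exact: nbhs_dnbhs_neq.
  rewrite distrC /= -[X in _ - X](mulKf h0) -[_ *: _]/(h^-1 * _) -mulrBr.
  rewrite normrM normfV mulrC ler_pdivrMr ?normr_gt0//.
  apply: le_trans (fC h) _; rewrite -real_normK ?num_real// expr2 mulrA.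
  have : `|h| < e / (`|C| + 1) by near: h; apply: dnbhs0_lt; rewrite divr_gt0.
  rewrite ltr_pdivlMr ?ltr_pwDr// => /ltW hC.
  apply: ler_wpM2r => //; apply: le_trans hC.
  by rewrite mulrC; apply: ler_wpM2l => //; rewrite (le_trans (ler_norm C))// lerDl.
by apply: DeriveDef; [apply/cvg_ex; exists c|exact: cvg_lim].
Unshelve. all: by end_near. Qed.

Section potential_lift.
Context {R : realType}.
Variables (L mu : R).

(** One-dimensional form of [potential_class]. That [dphi] is the derivative follows from the
    quadratic bounds, and for [mu > 0] a zero of [dphi] is the unique minimizer by strong
    convexity. *)
Definition line_potential (phi dphi : R -> R) : Prop :=
  [/\ continuous dphi,
      forall x y, mu / 2 * (x - y) ^+ 2 <= phi x - phi y - dphi y * (x - y)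
        <= L / 2 * (x - y) ^+ 2
    & exists2 x, dphi x = 0 & `|x| <= (Num.sqrt mu)^-1].

Definition lift_potential n (phi : R -> R) (x : 'rV[R]_n.+1) : R :=
  phi (x ord0 ord0) + mu / 2 * \sum_(j < n) x ord0 (lift ord0 j) ^+ 2.

Definition lift_gradient n (dphi : R -> R) (x : 'rV[R]_n.+1) : 'rV[R]_n.+1 :=
  mu *: x + (dphi (x ord0 ord0) - mu * x ord0 ord0) *: delta_mx ord0 ord0.

Lemma enorm_sqr n (x : 'rV[R]_n) : enorm x ^+ 2 = \sum_(i < n) x ord0 i ^+ 2.
Proof. by rewrite sqr_sqrtr// sumr_ge0// => i _; exact: sqr_ge0. Qed.

Lemma enorm_scale_delta n (h : R) (i : 'I_n) :
  enorm (h *: delta_mx ord0 i) ^+ 2 = h ^+ 2.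
Proof.
rewrite enorm_sqr (bigD1 i)//= big1 ?addr0 => [|j ji].
  by rewrite !mxE !eqxx mulr1.
by rewrite !mxE (negbTE ji) andbF mulr0 expr0n.
Qed.

Lemma dotrV_scale_delta n (x : 'rV[R]_n) (h : R) (i : 'I_n) :
  dotrV x (h *: delta_mx ord0 i) = h * x ord0 i.
Proof.
rewrite /dotrV (bigD1 i)//= big1 ?addr0 => [|j ji].
  by rewrite !mxE !eqxx mulr1 mulrC.
by rewrite !mxE (negbTE ji) andbF !mulr0.
Qed.

Lemma lift_gradient0 n dphi (x : 'rV[R]_n.+1) :
  lift_gradient dphi x ord0 ord0 = dphi (x ord0 ord0).
Proof. by rewrite !mxE !eqxx mulr1 addrC subrK. Qed.

Lemma lift_gradientS n dphi (x : 'rV[R]_n.+1) j :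
  lift_gradient dphi x ord0 (lift ord0 j) = mu * x ord0 (lift ord0 j).
Proof. by rewrite !mxE /= mulr0 addr0. Qed.

Hypotheses (mu0 : 0 < mu) (muL : mu <= L).
Variables (phi dphi : R -> R).
Hypothesis hphi : line_potential phi dphi.

(** The Bregman remainder is additive over coordinates, and a quadratic coordinate contributes
    exactly [mu / 2] times its squared increment. *)
Lemma lift_remainder n (x y : 'rV[R]_n.+1) :
  lift_potential phi x - lift_potential phi y
    - dotrV (lift_gradient dphi y) (x - y) =
  (phi (x ord0 ord0) - phi (y ord0 ord0)
    - dphi (y ord0 ord0) * (x ord0 ord0 - y ord0 ord0))
  + mu / 2 * \sum_(j < n) (x ord0 (lift ord0 j) - y ord0 (lift ord0 j)) ^+ 2.
Proof.
rewrite /dotrV big_ord_recl lift_gradient0.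
have -> : \sum_(j < n) lift_gradient dphi y ord0 (lift ord0 j) * (x - y) ord0 (lift ord0 j) =
    \sum_(j < n) (mu * y ord0 (lift ord0 j) *
    (x ord0 (lift ord0 j) - y ord0 (lift ord0 j))).
  by apply: eq_bigr => j _; rewrite lift_gradientS !mxE.
rewrite !mxE /lift_potential.
have -> : \sum_(j < n) (x ord0 (lift ord0 j) - y ord0 (lift ord0 j)) ^+ 2 =
    \sum_(j < n) x ord0 (lift ord0 j) ^+ 2
    - \sum_(j < n) y ord0 (lift ord0 j) ^+ 2
    - 2 / mu * \sum_(j < n) (mu * y ord0 (lift ord0 j) *
      (x ord0 (lift ord0 j) - y ord0 (lift ord0 j))).
  rewrite mulr_sumr -!sumrB; apply: eq_bigr => j _.
  by field; rewrite gt_eqF.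
by field; rewrite gt_eqF.
Qed.

Lemma lift_bounds n (x y : 'rV[R]_n.+1) :
  mu / 2 * enorm (x - y) ^+ 2 <=
    lift_potential phi x - lift_potential phi y
      - dotrV (lift_gradient dphi y) (x - y)
  <= L / 2 * enorm (x - y) ^+ 2.
Proof.
have [_ /(_ (x ord0 ord0) (y ord0 ord0)) /andP[lo hi] _] := hphi.
rewrite lift_remainder enorm_sqr big_ord_recl !mxE.
under eq_bigr do rewrite !mxE.
set s := \sum_(_ < n) _.
have s0 : 0 <= s by apply: sumr_ge0 => i _; exact: sqr_ge0.
have muLs : mu / 2 * s <= L / 2 * s by rewrite ler_wpM2r// ler_pM2r.
by apply/andP; split; rewrite [_ * (_ + s)]mulrDr lerD.
Qed.

Lemma lift_is_derive n (x : 'rV[R]_n.+1) i :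
  is_derive x (delta_mx ord0 i) (lift_potential phi)
    (lift_gradient dphi x ord0 i).
Proof.
apply: (@is_derive_quadratic_remainder _ _ _ _ _ _ (L / 2)) => h.
have := lift_bounds (h *: delta_mx ord0 i + x) x.
rewrite addrK enorm_scale_delta dotrV_scale_delta => /andP[lo hi].
rewrite ger0_norm//; apply: le_trans lo.
by rewrite mulr_ge0 ?sqr_ge0// divr_ge0// ltW.
Qed.

Lemma gradient_lift n (x : 'rV[R]_n.+1) :
  gradient (lift_potential phi) x = lift_gradient dphi x.
Proof.
by apply/rowP => i; rewrite mxE; have [_ ->] := lift_is_derive x i.
Qed.

Lemma line_differentiable x : differentiable phi x.
Proof.
apply/derivable1_diffP; apply: (@ex_derive _ _ _ _ _ _ (dphi x)).
apply: (@is_derive_quadratic_remainder _ _ _ _ _ _ (L / 2)) => h.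
have [_ /(_ (h *: 1 + x) x)] := hphi.
rewrite addrK -[_ *: _]/(h * 1) mulr1 => /andP[lo hi] _.
rewrite [h * dphi x]mulrC ger0_norm//; apply: le_trans lo.
by rewrite mulr_ge0 ?sqr_ge0// divr_ge0// ltW.
Qed.

Lemma line_continuous : continuous phi.
Proof. by move=> x; exact/differentiable_continuous/line_differentiable. Qed.

Lemma lift_potential_class n :
  potential_class L mu (lift_potential phi : 'rV[R]_n.+1 -> R).
Proof.
have [cdphi _ [xs dxs nxs]] := hphi.
split; first split.
(* Partial derivatives alone do not give total differentiability, which is therefore obtained by
   composition. *)
- move=> x; apply: differentiableD.
    apply: (@differentiable_comp _ _ _ _ (fun x : 'rV[R]_n.+1 => x ord0 ord0) phi).
      exact: differentiable_coord.
    exact: line_differentiable.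
  apply: differentiableM; first exact: differentiable_cst.
  rewrite (_ : (fun _ => _) = \sum_(j < n)
      (fun x : 'rV[R]_n.+1 => x ord0 (lift ord0 j)) ^+ 2); last first.
    by apply/funext => y; rewrite fct_sumE; apply: eq_bigr => j _; rewrite exprfctE.
  apply: differentiable_sum => j; apply: differentiableX.
  exact: differentiable_coord.
- rewrite (_ : gradient _ = lift_gradient dphi); last first.
    by apply/funext => x; rewrite gradient_lift.
  have cc : continuous (fun x : 'rV[R]_n.+1 => x ord0 ord0).
    exact: coord_continuous.
  have cd : continuous (fun x : 'rV[R]_n.+1 =>
      dphi (x ord0 ord0) - mu * x ord0 ord0).
    have c1 : continuous (fun t : R => dphi t - mu * t).
      move=> t; apply: (@cvgB _ _ _ _ _ dphi (fun u => mu * u)).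
        exact: cdphi.
      exact: mulrl_continuous.
    by move=> x; exact: (cvg_comp _ _ (cc x) (c1 _)).
  have c1 : continuous (fun y : 'rV[R]_n.+1 => mu *: y).
    exact: scaler_continuous.
  have c2 : continuous (fun y : 'rV[R]_n.+1 =>
      (dphi (y ord0 ord0) - mu * y ord0 ord0) *:
      (delta_mx ord0 ord0 : 'rV[R]_n.+1)).
    have c3 : continuous (fun a : R => a *: (delta_mx ord0 ord0 : 'rV[R]_n.+1)).
      exact: scalel_continuous.
    by move=> y; exact: (cvg_comp _ _ (cd y) (c3 _)).
  by move=> x; exact: (continuousD (c1 x) (c2 x)).
- by move=> x y; rewrite gradient_lift; exact: lift_bounds.
(* The gradient vanishes here, so the lower quadratic bound based at this point yields both
   minimality and uniqueness. *)
exists (xs *: delta_mx ord0 ord0).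
  set z := _ *: _; have g0 : lift_gradient dphi z = 0.
    rewrite /lift_gradient mxE mxE !eqxx mulr1 dxs sub0r scaleNr.
    by rewrite /z scalerA subrr.
  have lo y : mu / 2 * enorm (y - z) ^+ 2 <= lift_potential phi y - lift_potential phi z.
    have /andP[+ _] := lift_bounds y z.
    rewrite g0 (_ : dotrV 0 _ = 0) ?subr0// /dotrV big1// => i _.
    by rewrite mxE mul0r.
  split=> [y|y ymin].
    rewrite -subr_ge0; apply: le_trans (lo y).
    by rewrite mulr_ge0 ?sqr_ge0// divr_ge0// ltW.
  have : enorm (y - z) ^+ 2 <= 0.
    have := lo y; have := ymin z; rewrite -subr_le0 => h1 h2.
    by have := le_trans h2 h1; rewrite pmulr_rle0// divr_gt0.
  rewrite enorm_sqr => sle0; apply/eqP; rewrite -subr_eq0; apply/eqP/rowP => i.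
  have : \sum_(j < n.+1) (y - z) ord0 j ^+ 2 == 0.
    by rewrite eq_le sle0 sumr_ge0// => j _; exact: sqr_ge0.
  rewrite psumr_eq0 => [/allP/(_ i)|j _]; last exact: sqr_ge0.
  by rewrite mem_index_enum sqrf_eq0 => /(_ isT)/eqP ->; rewrite mxE.
by rewrite -[enorm _]ger0_norm ?sqrtr_ge0// -sqrtr_sqr enorm_scale_delta sqrtr_sqr.
Qed.

End potential_lift.

(** * Their Gibbs measures *)

Section gibbs_lift.
Context {R : realType}.
Variable mu : R.
Hypothesis mu0 : 0 < mu.
Local Notation leb := (@lebesgue_measure R).

Definition gauss_weight n (v : 'rV[R]_n) : R :=
  expR (- (mu / 2 * \sum_(j < n) v ord0 j ^+ 2)).

(** The factor that the remaining coordinates contribute to every integral; positive and finite, it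
    cancels in [gibbs_lift]. *)
Definition gauss_mass n : \bar R :=
  (\int[lebesgue_rV R n]_v (gauss_weight v)%:E)%E.

Lemma measurable_gauss_weight n : measurable_fun setT (@gauss_weight n).
Proof.
apply: measurableT_comp => //; apply: measurableT_comp => //.
apply: measurable_funM => //; apply: measurable_sum => j.
apply: measurable_funX; exact: measurable_coord.
Qed.

Lemma expRN_lift_potential n phi (x : 'rV[R]_n.+1) :
  expR (- lift_potential mu phi x) =
  expR (- phi (x ord0 ord0)) * gauss_weight (\row_(j < n) x ord0 (lift ord0 j)).
Proof.
rewrite /lift_potential /gauss_weight opprD expRD.
by under [in RHS]eq_bigr do rewrite mxE.
Qed.

Lemma measurable_slab n (A : set R) : measurable A ->
  measurable [set x : 'rV[R]_n.+1 | A (x ord0 ord0)].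
Proof.
move=> mA; set D := [set _ | _]; rewrite -[D]setTI.
exact: (@measurable_coord _ _ n.+1 ord0).
Qed.

(** Tonelli for the first coordinate against the others, Lebesgue measure on rows being the image of
    a product under [cons_rV]. *)
Lemma integral_lift_potential n (A : set R) (phi : R -> R) :
  measurable A -> measurable_fun [set: R] phi ->
  (\int[lebesgue_rV R n.+1]_(x in [set x : 'rV[R]_n.+1 | A (x ord0 ord0)])
     (expR (- lift_potential mu phi x))%:E =
   (\int[leb]_(t in A) (expR (- phi t))%:E) * gauss_mass n)%E.
Proof.
move=> mA mphi.
have me : measurable_fun [set: R] (fun t => expR (- phi t)).
  by apply: measurableT_comp => //; apply: measurableT_comp.
pose D := [set x : 'rV[R]_n.+1 | A (x ord0 ord0)].
have mD : measurable D by exact: measurable_slab.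
have mrow : measurable_fun setT (fun x : 'rV[R]_n.+1 =>
    \row_(j < n) x ord0 (lift ord0 j)).
  apply: measurable_fun_rV => i; under eq_fun do rewrite mxE.
  exact: measurable_coord.
have mf : measurable_fun [set: 'rV[R]_n.+1]
    (fun x : 'rV[R]_n.+1 => (expR (- lift_potential mu phi x))%:E).
  apply/measurable_EFinP; under eq_fun do rewrite expRN_lift_potential.
  apply: measurable_funM.
    by apply: (measurableT_comp me); exact: measurable_coord.
  by apply: (measurableT_comp (@measurable_gauss_weight n)).
rewrite /= [LHS](ge0_integral_pushforward (@measurable_cons_rV R n)
  (product_measure1 leb (lebesgue_rV R n)) mD (measurable_funTS mf)); last first.
  by move=> x _; rewrite lee_fin expR_ge0.
pose F (z : measurableTypeR R * 'rV[R]_n) : \bar R :=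
  ((\1_A z.1 * expR (- phi z.1)) * gauss_weight z.2)%:E.
have mA1 : measurable_fun [set: R] (fun t : R => \1_A t * expR (- phi t)).
  by apply: measurable_funM => //; exact: measurable_indic.
have mF : measurable_fun setT F.
  apply/measurable_EFinP; apply: measurable_funM.
    exact: (measurableT_comp mA1).
  exact: (measurableT_comp (@measurable_gauss_weight n)).
have F0 z : (0 <= F z)%E.
  by rewrite lee_fin !mulr_ge0// expR_ge0.
(* Turning the slab into an indicator of the first variable makes the integrand a product on the
   whole product space. *)
transitivity ((\int[leb \x (lebesgue_rV R n)]_z F z)%E).
  rewrite integral_mkcond; apply: eq_integral => z _.
  rewrite patchE /F /=; have z1 : cons_rV z ord0 ord0 = z.1.
    by rewrite mxE unlift_none.
  have z2 : \row_(j < n) cons_rV z ord0 (lift ord0 j) = z.2.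
    by apply/rowP => j; rewrite !mxE liftK.
  rewrite expRN_lift_potential z1 z2 indicE.
  have -> : (z \in @cons_rV R n @^-1` D) = (z.1 \in A).
    by apply/idP/idP; rewrite !inE /D /= z1.
  by case: ifP => _; rewrite ?mul1r ?mul0r.
rewrite fubini_tonelli1// /fubini_F.
transitivity (\int[leb]_t ((\1_A t * expR (- phi t))%:E * gauss_mass n))%E.
  apply: eq_integral => t _; rewrite /gauss_mass -ge0_integralZl//.
    by apply/measurable_EFinP; exact: measurable_gauss_weight.
  by move=> v _; rewrite lee_fin expR_ge0.
rewrite ge0_integralZr//.
- congr (_ * _)%E; rewrite [RHS]integral_mkcond; apply: eq_integral => t _.
  by rewrite patchE indicE; case: ifP => _; rewrite ?mul1r ?mul0r.
- exact/measurable_EFinP.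
- by apply: integral_ge0 => v _; rewrite lee_fin expR_ge0.
Qed.

(** Normalization of the normal density with variance [1 / mu]. *)
Lemma integral_gauss_line :
  (\int[leb]_t (expR (- (mu / 2 * t ^+ 2)))%:E =
   (Num.sqrt (2 * pi / mu))%:E)%E.
Proof.
pose s := (Num.sqrt mu)^-1.
have s0 : s != 0 by rewrite invr_neq0// sqrtr_eq0 -ltNge.
have s2 : s ^+ 2 = mu^-1 by rewrite exprVn sqr_sqrtr// ltW.
have p0 := normal_peak_gt0 s0.
have nE t : normal_pdf 0 s t = normal_peak s * expR (- (mu / 2 * t ^+ 2)).
  rewrite normal_pdfE// /normal_fun subr0 s2; congr (_ * expR _).
  by field; rewrite gt_eqF.
have := integral_normal_pdf 0 s; under eq_integral do rewrite nE EFinM.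
rewrite ge0_integralZl//; last 2 first.
- apply/measurable_EFinP; apply: measurableT_comp => //.
  apply: measurableT_comp => //; exact: measurable_funM.
- by rewrite lee_fin ltW.
set J := (\int[_]_t _)%E => pJ.
have -> : J = ((normal_peak s)^-1%:E * ((normal_peak s)%:E * J))%E.
  by rewrite muleA -EFinM mulVf ?gt_eqF// mul1e.
rewrite pJ mule1 /normal_peak invrK s2 -mulr_natl; congr (Num.sqrt _)%:E.
by rewrite mulrA mulrAC.
Qed.

(** Each induction step views the Gaussian weight as the density of a lifted one-dimensional
    quadratic; in dimension 0 the measure is a Dirac mass. *)
Lemma gauss_mass_gt0 n : (0 < gauss_mass n)%E /\ gauss_mass n \is a fin_num.
Proof.
elim: n => [|n [IH1 IH2]].
  rewrite /gauss_mass integral_dirac//.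
    rewrite diracT mul1e /gauss_weight big_ord0 mulr0 oppr0 expR0.
    by rewrite lte01.
  by apply/measurable_EFinP; exact: measurable_gauss_weight.
have -> : gauss_mass n.+1 =
    (\int[lebesgue_rV R n.+1]_(x in [set x : 'rV[R]_n.+1 | setT (x ord0 ord0)])
     (expR (- lift_potential mu (fun t => mu / 2 * t ^+ 2) x))%:E)%E.
  rewrite /gauss_mass; congr (integral _ _ _).
  apply/funext => x; rewrite /gauss_weight /lift_potential.
  by rewrite big_ord_recl mulrDr.
rewrite integral_lift_potential//; last first.
  exact: measurable_funM.
rewrite integral_gauss_line; split; last by rewrite fin_numM.
by rewrite mule_gt0// lte_fin sqrtr_gt0 divr_gt0// mulr_gt0// pi_gt0.
Qed.

End gibbs_lift.

(** Lebesgue measure and its image under the translation agree on the intervals []u, v]], hence on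
    all measurable sets. *)
Lemma integral_shift {R : realType} (a : R) (f : R -> \bar R) :
  measurable_fun [set: R] f -> (forall t, 0 <= f t)%E ->
  forall A : set R, measurable A ->
  (\int[lebesgue_measure]_(t in A) f t =
   \int[lebesgue_measure]_(t in [set t | A (t + a)%R]) f (t + a)%R)%E.
Proof.
move=> mf f0 A mA.
have ma : measurable_fun [set: measurableTypeR R] (fun t : measurableTypeR R => t + a : measurableTypeR R).
  exact: measurable_funD.
rewrite -(@ge0_integral_pushforward _ _ _ _ _ _ ma)//; last exact: measurable_funTS.
apply: eq_measure_integral => //= B mB _.
apply: lebesgue_measure_unique => //= _ [[u v]] _ <-.
rewrite /pushforward (_ : _ @^-1` _ = `]u - a, v - a]%classic); last first.
  by apply/seteqP; split=> t /=; rewrite !in_itv/= ltrBlDr lerBrDr.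
rewrite !lebesgue_measure_itv/= !lte_fin ltrD2r -!EFinD.
by case: ifP => // _; rewrite opprD opprK addrACA addNr addr0.
Qed.

(** * Masses of Gibbs densities on the line *)

Section line_mass.
Context {R : realType}.
Local Notation leb := (@lebesgue_measure R).

Definition line_mass (phi : R -> R) (A : set R) : \bar R :=
  (\int[leb]_(t in A) (expR (- phi t))%:E)%E.

Lemma measurable_expRN (phi : R -> R) : measurable_fun [set: R] phi ->
  measurable_fun [set: R] (fun t => (expR (- phi t))%:E).
Proof.
move=> mphi; apply/measurable_EFinP; apply: measurableT_comp => //.
exact: measurableT_comp.
Qed.

Lemma line_mass_ge0 phi A : (0 <= line_mass phi A)%E.
Proof. by apply: integral_ge0 => t _; rewrite lee_fin expR_ge0. Qed.

Lemma measurable_below (a : R) : measurable [set t : R | t < a].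
Proof. by rewrite -set_itvNyo; exact: measurable_itv. Qed.

Lemma measurable_above (a : R) : measurable [set t : R | a <= t].
Proof. by rewrite -set_itvcy; exact: measurable_itv. Qed.

Lemma measurable_between (a b : R) : measurable [set t : R | a <= t < b].
Proof. by rewrite -set_itvco; exact: measurable_itv. Qed.

Lemma line_mass_split phi (a b : R) : measurable_fun [set: R] phi -> a <= b ->
  (line_mass phi [set t | (t < a)%R] + line_mass phi [set t | (b <= t)%R]
    + line_mass phi [set t | (a <= t < b)%R] = line_mass phi setT)%E.
Proof.
move=> mphi ab; have me := measurable_expRN mphi.
have ma := measurable_below a; have mb := measurable_above b.
have mab := measurable_between a b.
rewrite /line_mass -ge0_integral_setU//=.
- rewrite -ge0_integral_setU//=.
  + congr (integral _ _ _); apply/seteqP; split=> // t _ /=.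
    have [ta|at_] := ltP t a; first by left; left.
    by have [bt|tb] := leP b t; [left; right|right].
  + exact: measurableU.
  + exact: measurable_funTS.
  + apply/disj_setPS => t /= [[] h1 /andP[h2 h3]]; move: h1 h2 h3 => /=; lra.
- exact: measurable_funTS.
- apply/disj_setPS => t /= [h1 h2]; move: h1 h2 => /=; lra.
Qed.

Lemma line_mass_le phi A : measurable_fun [set: R] phi -> measurable A ->
  (line_mass phi A <= line_mass phi setT)%E.
Proof.
move=> mphi mA; apply: ge0_subset_integral => //.
exact: measurable_expRN.
Qed.

Lemma integral_gauss_line_shift (m a : R) : 0 < m ->
  (\int[leb]_t (expR (- (m / 2 * (t - a) ^+ 2)))%:E =
   (Num.sqrt (2 * pi / m))%:E)%E.
Proof.
move=> m0; rewrite (integral_shift a)//=.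
- rewrite -(integral_gauss_line m0); congr (integral _ _ _).
  by apply/funext => t; rewrite addrK.
- apply: (@measurable_expRN (fun t => m / 2 * (t - a) ^+ 2)).
  by apply: measurable_funM => //; apply: measurable_funX; exact: measurable_funB.
Qed.

(** The density lies between two Gaussian profiles of curvatures [L] and [mu] centered at the
    minimizer. *)
Lemma line_mass_gt0 (L mu : R) phi dphi : 0 < mu -> mu <= L ->
  line_potential L mu phi dphi ->
  (0 < line_mass phi setT)%E /\ line_mass phi setT \is a fin_num.
Proof.
move=> mu0 muL hphi; have [_ bnd [xs dxs _]] := hphi.
have mphi : measurable_fun [set: R] phi.
  apply: continuous_measurable_fun; exact: (line_continuous mu0 hphi).
have bnd' t : phi xs + mu / 2 * (t - xs) ^+ 2 <= phi t <=
    phi xs + L / 2 * (t - xs) ^+ 2.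
  by have := bnd t xs; rewrite dxs mul0r subr0 lerBrDl lerBlDl.
have L0 : 0 < L by exact: lt_le_trans muL.
have gaussE m : 0 < m -> (\int[leb]_t (expR (- (phi xs + m / 2 * (t - xs) ^+ 2)))%:E =
    (expR (- phi xs) * Num.sqrt (2 * pi / m))%:E)%E.
  move=> m0; rewrite EFinM -(integral_gauss_line_shift xs m0) -ge0_integralZl//.
  - by apply: eq_integral => t _; rewrite opprD expRD EFinM.
  - apply: (@measurable_expRN (fun t => m / 2 * (t - xs) ^+ 2)).
    by apply: measurable_funM => //; apply: measurable_funX; exact: measurable_funB.
have mg m : measurable_fun [set: R]
    (fun t => (expR (- (phi xs + m / 2 * (t - xs) ^+ 2)))%:E).
  apply: (@measurable_expRN (fun t => phi xs + m / 2 * (t - xs) ^+ 2)).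
  apply: measurable_funD => //.
  by apply: measurable_funM => //; apply: measurable_funX; exact: measurable_funB.
split.
  apply: (@lt_le_trans _ _ (expR (- phi xs) * Num.sqrt (2 * pi / L))%:E).
    by rewrite lte_fin mulr_gt0 ?expR_gt0// sqrtr_gt0 divr_gt0// mulr_gt0// pi_gt0.
  rewrite -gaussE//; apply: ge0_le_integral => //.
  - exact: mg.
  - exact: measurable_expRN.
  - by move=> t _; rewrite lee_fin ler_expR lerN2; have /andP[] := bnd' t.
rewrite ge0_fin_numE ?line_mass_ge0//.
apply: (@le_lt_trans _ _ (expR (- phi xs) * Num.sqrt (2 * pi / mu))%:E); last exact: ltry.
rewrite -gaussE//; apply: ge0_le_integral => //.
- exact: measurable_expRN.
- exact: mg.
- by move=> t _; rewrite lee_fin ler_expR lerN2; have /andP[] := bnd' t.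
Qed.

Lemma gibbs_lift (L mu : R) phi dphi n (A : set R) : 0 < mu -> mu <= L ->
  line_potential L mu phi dphi -> measurable A ->
  (gibbs (lift_potential mu phi) [set x : 'rV[R]_n.+1 | A (x ord0 ord0)] =
   (fine (line_mass phi setT))^-1%:E * line_mass phi A)%E.
Proof.
move=> mu0 muL hphi mA.
have mphi : measurable_fun [set: R] phi.
  apply: continuous_measurable_fun; exact: (line_continuous mu0 hphi).
have [J0 Jfin] := line_mass_gt0 mu0 muL hphi.
have [Z0 Zfin] := gauss_mass_gt0 mu0 n.
have ZE := fineK Zfin; have JE := fineK Jfin.
have Z0' : 0 < fine (gauss_mass mu n) by rewrite fine_gt0// Z0 ltey_eq Zfin.
have J0' : 0 < fine (line_mass phi setT) by rewrite fine_gt0// J0 ltey_eq Jfin.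
rewrite /gibbs /partition_function (integral_lift_potential mu n mA mphi).
have -> : (\int[lebesgue_rV R n.+1]_x (expR (- lift_potential mu phi x))%:E =
    line_mass phi setT * gauss_mass mu n)%E.
  exact: (integral_lift_potential mu n measurableT mphi).
rewrite -/(line_mass phi A) -ZE -JE -EFinM /=.
rewrite muleCA invfM EFinM -!muleA muleC -!muleA.
by rewrite [X in (_ * X)%E]muleA -EFinM mulVf ?gt_eqF// mul1e.
Qed.

End line_mass.

(** * Two shifted Gaussian targets and the half-space separating them *)

Section gauss_pair.
Context {R : realType}.
Variables (mu : R).
Hypothesis mu0 : 0 < mu.

Definition shifted_square (a t : R) : R := mu / 2 * (t - a) ^+ 2.

Lemma line_potential_square (L a : R) : mu <= L -> `|a| <= (Num.sqrt mu)^-1 ->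
  line_potential L mu (shifted_square a) (fun t => mu * (t - a)).
Proof.
move=> muL aM; split.
- move=> t; apply: (@continuous_comp _ _ _ (fun t => t - a) (fun t => mu * t)).
    by apply: continuousB => //; exact: cst_continuous.
  exact: mulrl_continuous.
- move=> x y; rewrite /shifted_square.
  have -> : mu / 2 * (x - a) ^+ 2 - mu / 2 * (y - a) ^+ 2 - mu * (y - a) * (x - y)
    = mu / 2 * (x - y) ^+ 2 by field.
  by rewrite lexx ler_wpM2r ?sqr_ge0// ler_pM2r.
by exists a; rewrite ?subrr ?mulr0.
Qed.

Lemma measurable_shifted_square a : measurable_fun [set: R] (shifted_square a).
Proof.
by apply: measurable_funM => //; apply: measurable_funX; exact: measurable_funB.
Qed.

Lemma line_mass_square_shift (a : R) (A : set R) : measurable A ->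
  line_mass (shifted_square a) A =
  line_mass (shifted_square 0) [set t | A (t + a)].
Proof.
move=> mA; rewrite /line_mass (integral_shift a)//.
  by apply: eq_integral => t _; rewrite /shifted_square addrK subr0.
by apply: measurable_expRN; exact: measurable_shifted_square.
Qed.

(** After centering, the two events become [t < - b] and [b <= t]. They leave out [[-b, b)], whose
    mass is at least its length [2 b] times the density at [b]. *)
Lemma gibbs_square_halfspaces (L b : R) n : mu <= L ->
  0 < b -> b * Num.sqrt mu <= 1 / 2 ->
  (gibbs (lift_potential mu (shifted_square b))
     [set x : 'rV[R]_n.+1 | (x ord0 ord0 < 0)%R] +
   gibbs (lift_potential mu (shifted_square (- b)))
     (~` [set x : 'rV[R]_n.+1 | (x ord0 ord0 < 0)%R]) <=
   (1 - 61%:R / 100%:R * (b * Num.sqrt mu))%:E)%E.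
Proof.
move=> muL b0 bmu.
have s0 : 0 < Num.sqrt mu by rewrite sqrtr_gt0.
have bM : b <= (Num.sqrt mu)^-1.
  rewrite -[_^-1]mul1r ler_pdivlMr//; apply: le_trans bmu _; lra.
have hp : line_potential L mu (shifted_square b) (fun t => mu * (t - b)).
  by apply: line_potential_square => //; rewrite gtr0_norm.
have hm : line_potential L mu (shifted_square (- b)) (fun t => mu * (t - - b)).
  by apply: line_potential_square => //; rewrite normrN gtr0_norm.
have -> : ~` [set x : 'rV[R]_n.+1 | (x ord0 ord0 < 0)%R] =
    [set x | [set t : R | (0 <= t)%R] (x ord0 ord0)].
  by apply/seteqP; split => x /=; [move/negP; rewrite -leNgt|rewrite leNgt => /negP].
rewrite (gibbs_lift n mu0 muL hp (measurable_below 0)).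
rewrite (gibbs_lift n mu0 muL hm (measurable_above 0)).
pose J := Num.sqrt (2 * pi / mu).
have J0 : 0 < J by rewrite sqrtr_gt0 divr_gt0// mulr_gt0// pi_gt0.
have JE a : line_mass (shifted_square a) setT = J%:E.
  by rewrite -(integral_gauss_line_shift a mu0).
rewrite !JE/= (line_mass_square_shift b (measurable_below 0)).
rewrite (line_mass_square_shift (- b) (measurable_above 0)).
have -> : [set t : R | [set t | t < 0] (t + b)] = [set t | t < - b].
  by apply/seteqP; split => t /=; lra.
have -> : [set t : R | [set t | 0 <= t] (t - b)] = [set t | b <= t].
  by apply/seteqP; split => t /=; lra.
have m0 := measurable_shifted_square 0.
have bb : - b <= b by lra.
have := line_mass_split m0 bb; rewrite JE.
have mid : ((2 * b * expR (- (mu / 2 * b ^+ 2)))%:E <=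
    line_mass (shifted_square 0) [set t | (- b <= t < b)%R])%E.
  have mI := measurable_between (- b) b.
  apply: (@le_trans _ _ (\int[lebesgue_measure]_(t in [set t | (- b <= t < b)%R])
      (expR (- (mu / 2 * b ^+ 2)))%:E)%E).
    rewrite integral_cst//= -set_itvco lebesgue_measure_itv/= lte_fin.
    have -> : - b < b by lra.
    by rewrite -EFinD -EFinM lee_fin; lra.
  apply: ge0_le_integral => //.
  - by apply: measurable_funTS; exact: measurable_expRN.
  - move=> t /andP[t1 t2]; rewrite lee_fin ler_expR lerN2 /shifted_square subr0.
    apply: ler_wpM2l; first by rewrite divr_ge0// ltW.
    by rewrite -subr_ge0 subr_sqr mulr_ge0//; lra.
set A1 := line_mass _ _; set A2 := line_mass _ _; set A3 := line_mass _ _.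
have A1J : (A1 <= J%:E)%E by rewrite -(JE 0) line_mass_le//; exact: measurable_below.
have A2J : (A2 <= J%:E)%E by rewrite -(JE 0) line_mass_le//; exact: measurable_above.
have A3J : (A3 <= J%:E)%E by rewrite -(JE 0) line_mass_le//; exact: measurable_between.
have fin A : (0 <= A)%E -> (A <= J%:E)%E -> A = (fine A)%:E.
  by move=> A0 AJ; rewrite fineK// ge0_fin_numE//; apply: le_lt_trans AJ (ltry _).
move: mid; rewrite -/A3.
rewrite (fin A1) ?line_mass_ge0// (fin A2) ?line_mass_ge0// (fin A3) ?line_mass_ge0//.
rewrite -!EFinM -!EFinD !lee_fin => mid [sumJ].
(* From [exp (- u) >= 1 - u] with [u = (b sqrt mu)^2 / 2 <= 1 / 8]. *)
have e78 : 7 / 8 <= expR (- (mu / 2 * b ^+ 2)).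
  apply: le_trans (expR_ge1Dx _).
  have : (b * Num.sqrt mu) ^+ 2 <= (1 / 2) ^+ 2.
    by rewrite lerXn2r ?nnegrE// mulr_ge0// ltW.
  rewrite exprMn sqr_sqrtr ?(ltW mu0)//; lra.
(* The left side is [sqrt (2 pi)], below [sqrt 8] since [pi < 4]. The constant is just under
   [(7 / 4) / (61 / 100)], the most the final comparison allows. *)
have Jle : J * Num.sqrt mu <= 28688%:R / 10000%:R.
  rewrite -sqrtrM ?divr_ge0 ?mulr_ge0 ?pi_ge0 ?(ltW mu0)//.
  rewrite divfK ?gt_eqF// -(@ger0_norm _ (28688%:R / 10000%:R))// -sqrtr_sqr ler_sqrt//.
  have := @pihalf_lt2 R; lra.
rewrite -mulrDr mulrC ler_pdivrMr//.
have h1 : b * (7 / 8) <= b * expR (- (mu / 2 * b ^+ 2)) by rewrite ler_pM2l.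
have h2 : b * (J * Num.sqrt mu) <= b * (28688%:R / 10000%:R) by rewrite ler_pM2l.
have := mid; rewrite mulrBl mul1r; lra.
Qed.

End gauss_pair.

(** * Huber potentials and their concentration on a window *)

Section huber.
Context {R : realType}.
Variables (L mu : R).
Hypotheses (mu0 : 0 < mu) (muL : mu <= L).

Definition clip (w u : R) : R := if u < - w then - w else if u < w then u else w.

(** For [w >= 0] this is [u^2 / 2] when [|u| <= w] and [w |u| - w^2 / 2] beyond. Written through its
    derivative [clip], it has one formula in both regimes. *)
Definition huber (w u : R) : R := clip w u * (u - clip w u / 2).

Definition huber_potential (w a t : R) : R :=
  mu / 2 * t ^+ 2 + (L - mu) * huber w (t - a).

Definition huber_slope (w a t : R) : R := mu * t + (L - mu) * clip w (t - a).

Lemma clip_bounds w u : 0 <= w -> - w <= clip w u <= w.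
Proof. by move=> w0; rewrite /clip; case: ltP => ?; [lra|case: ltP => ?; lra]. Qed.

(** The variational inequality of the projection onto [[-w, w]]. *)
Lemma clip_projection w u v : - w <= v <= w ->
  0 <= (clip w u - v) * (u - clip w u).
Proof.
move=> /andP[v1 v2]; rewrite /clip; case: ltP => h1.
  by rewrite mulr_le0//; lra.
by case: ltP => h2; [rewrite subrr mulr0|rewrite mulr_ge0//; lra].
Qed.

(** With [a], [b] the projections of [x], [y], the remainder equals
    [(a - b) (x - a) + (a - b)^2 / 2], and it falls short of the upper bound by [(b - a) (y - b) +
    ((x - a) - (y - b))^2 / 2]. Both products are nonnegative by [clip_projection]. *)
Lemma huber_bounds w x y : 0 <= w ->
  0 <= huber w x - huber w y - clip w y * (x - y) <= (x - y) ^+ 2 / 2.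
Proof.
move=> w0; rewrite /huber.
have := clip_projection x (clip_bounds y w0).
have := clip_projection y (clip_bounds x w0).
set a := clip w x; set b := clip w y => h1 h2.
have := sqr_ge0 (a - b); have := sqr_ge0 ((x - a) - (y - b)).
by rewrite !expr2 => h3 h4; apply/andP; split; nra.
Qed.

Lemma clipE w u : 0 <= w -> clip w u = Num.max (- w) (Num.min u w).
Proof.
move=> w0; rewrite /clip; case: ltP => h1.
  by rewrite min_l ?max_l//; lra.
by case: ltP => h2; rewrite max_r//; lra.
Qed.

Lemma continuous_clip w : 0 <= w -> continuous (clip w).
Proof.
move=> w0; rewrite (_ : clip w = cst (- w) \max ((fun u => u) \min cst w)).
  move=> u; apply: continuous_max; first exact: cst_continuous.
  by apply: continuous_min; [exact: cvg_id|exact: cst_continuous].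
by apply/funext => u; exact: clipE.
Qed.

Lemma continuous_huber_slope w a : 0 <= w -> continuous (huber_slope w a).
Proof.
move=> w0 t; apply: (@continuousD _ _ _ (fun t => mu * t)
  (fun t => (L - mu) * clip w (t - a))); first exact: mulrl_continuous.
apply: (@continuous_comp _ _ _ (fun t => clip w (t - a)) (fun t => (L - mu) * t)).
  apply: (@continuous_comp _ _ _ (fun t => t - a) (clip w)).
    by apply: continuousB => //; exact: cst_continuous.
  exact: continuous_clip.
exact: mulrl_continuous.
Qed.

Lemma line_potential_huber w a : 0 <= w -> 0 <= a -> a <= (Num.sqrt mu)^-1 ->
  mu / L * a < w -> line_potential L mu (huber_potential w a) (huber_slope w a).
Proof.
move=> w0 a0 aM aw; have L0 : 0 < L by exact: lt_le_trans muL.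
have muL1 : mu / L <= 1 by rewrite ler_pdivrMr// mul1r.
have muL0 : 0 < mu / L by rewrite divr_gt0.
split; first exact: continuous_huber_slope.
- move=> x y; have /andP[lo hi] := huber_bounds (x - a) (y - a) w0.
  have xy : x - a - (y - a) = x - y by ring.
  rewrite xy in lo hi.
  have -> : huber_potential w a x - huber_potential w a y
      - huber_slope w a y * (x - y) = mu / 2 * (x - y) ^+ 2 + (L - mu) *
      (huber w (x - a) - huber w (y - a) - clip w (y - a) * (x - y)).
    by rewrite /huber_potential /huber_slope; field.
  have Lmu : 0 <= L - mu by rewrite subr_ge0.
  have := ler_wpM2l Lmu lo; have := ler_wpM2l Lmu hi; rewrite mulr0.
  set h := (L - mu) * (_ - _ - _); lra.
(* The zero of [mu t + (L - mu) (t - a)], the slope inside the window; [mu / L * a < w] places it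
   there. *)
exists ((1 - mu / L) * a).
  rewrite /huber_slope /clip; have -> : (1 - mu / L) * a - a = - (mu / L * a) by ring.
  rewrite ltrN2 ltNge (ltW aw)/=.
  have -> : - (mu / L * a) < w.
    by apply: le_lt_trans aw; have := mulr_ge0 (ltW muL0) a0; lra.
  by field; rewrite gt_eqF.
rewrite ger0_norm; last by rewrite mulr_ge0// subr_ge0.
by apply: le_trans aM; rewrite ler_piMl//; lra.
Qed.

(** Here and in the next lemma the value no longer contains [a]: a query outside the window reveals
    only its side. *)
Lemma huber_slope_left w a t : t < a - w ->
  huber_slope w a t = mu * t - (L - mu) * w.
Proof.
move=> h; rewrite /huber_slope /clip; have -> : t - a < - w by lra.
by rewrite mulrN.
Qed.

Lemma huber_slope_right w a t : 0 <= w -> a + w <= t ->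
  huber_slope w a t = mu * t + (L - mu) * w.
Proof.
move=> w0 h; rewrite /huber_slope /clip ltNge.
have -> : - w <= t - a by lra.
by rewrite /= ltNge; have -> : w <= t - a by lra.
Qed.

Lemma huber_slope_mid w a t : a - w <= t < a + w ->
  huber_slope w a t = mu * t + (L - mu) * (t - a).
Proof.
move=> /andP[h1 h2]; rewrite /huber_slope /clip ltNge.
have -> : - w <= t - a by lra.
by have -> : t - a < w by lra.
Qed.

(** Translation by [h] preserves the total mass and multiplies the density on [A] by at least
    [exp 12 >= 13]. *)
Lemma line_mass_tail_le (phi : R -> R) h (A : set R) : measurable_fun [set: R] phi ->
  measurable A -> (forall t, A t -> phi (t + h) + 12 <= phi t) ->
  (line_mass phi A <= (13^-1)%:E * line_mass phi setT)%E.
Proof.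
move=> mphi mA drop; have me := measurable_expRN mphi.
have mh : measurable_fun [set: R] (fun t => (expR (- phi (t + h)))%:E).
  by apply: (@measurable_expRN _ (fun t => phi (t + h)));
    apply: (measurableT_comp mphi); exact: measurable_funD.
have e13 : expR (- 12) <= 13^-1 :> R.
  rewrite expRN lef_pV2 ?posrE ?expR_gt0//.
  by have := @expR_ge1Dx R 12; lra.
have -> : line_mass phi setT =
    (\int[lebesgue_measure]_t (expR (- phi (t + h)))%:E)%E.
  by rewrite /line_mass (integral_shift h).
rewrite -ge0_integralZl//.
apply: (@le_trans _ _ (\int[lebesgue_measure]_(t in A)
    ((13^-1)%:E * (expR (- phi (t + h)))%:E))%E).
  apply: ge0_le_integral => //.
  - exact: measurable_funTS.
  - by apply: measurable_funTS; exact: measurable_funeM.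
  - move=> t At; rewrite -EFinM lee_fin.
    apply: (@le_trans _ _ (expR (- 12) * expR (- phi (t + h)))).
      by rewrite -expRD ler_expR; have := drop t At; lra.
    by rewrite ler_wpM2r// expR_ge0.
apply: ge0_subset_integral => //.
exact: measurable_funeM.
Qed.

(** A move by [w / 2 = 4 / sqrt L] from a tail towards the center lowers the potential by at least
    12. After it the slope is at least [4 sqrt L] on the right, and at most [- 3 sqrt L] on the
    left, where [mu a <= sqrt L] is lost. Each tail has mass at most [1 / 13], and
    [11 / 13 >= 5 / 6]. *)
Lemma gibbs_huber_window a n : 0 <= a -> a <= (Num.sqrt mu)^-1 ->
  let w := 8 / Num.sqrt L in
  line_potential L mu (huber_potential w a) (huber_slope w a) /\
  ((5 / 6)%:E <= gibbs (lift_potential mu (huber_potential w a))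
     [set x : 'rV[R]_n.+1 | (a - w <= x ord0 ord0 < a + w)%R])%E.
Proof.
move=> a0 aM w; have L0 : 0 < L by exact: lt_le_trans muL.
have l0 : 0 < Num.sqrt L by rewrite sqrtr_gt0.
have m0 : 0 < Num.sqrt mu by rewrite sqrtr_gt0.
have ml : Num.sqrt mu <= Num.sqrt L by rewrite ler_sqrt// ltW.
have mua : mu * a <= Num.sqrt mu.
  have := ler_wpM2l (ltW mu0) aM.
  by rewrite -{2}(sqr_sqrtr (ltW mu0)) expr2 mulfK// gt_eqF.
have w0 : 0 < w by rewrite divr_gt0.
have Lw : L * w = 8 * Num.sqrt L.
  by rewrite /w -{1}(sqr_sqrtr (ltW L0)); field; rewrite gt_eqF.
have lw : Num.sqrt L * w = 8 by rewrite /w; field; rewrite gt_eqF.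
clearbody w.
have aw : mu / L * a < w.
  by rewrite mulrAC ltr_pdivrMr// [w * L]mulrC Lw; lra.
have hphi := line_potential_huber (ltW w0) a0 aM aw; split=> //.
have mphi : measurable_fun [set: R] (huber_potential w a).
  by apply: continuous_measurable_fun; exact: (line_continuous mu0 hphi).
rewrite (gibbs_lift n mu0 muL hphi (measurable_between _ _)).
have [J0 Jfin] := line_mass_gt0 mu0 muL hphi.
have [_ bnd _] := hphi.
have muw x : 0 <= mu / 2 * x ^+ 2 by rewrite mulr_ge0 ?sqr_ge0// divr_ge0// ltW.
have Lmu : 0 <= L - mu by rewrite subr_ge0.
have drop_right t : a + w <= t ->
    huber_potential w a (t + - (w / 2)) + 12 <= huber_potential w a t.
  move=> ht; have /andP[lo _] := bnd t (t + - (w / 2)).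
  have := muw (t - (t + - (w / 2))).
  have : 4 * Num.sqrt L * (w / 2) <= huber_slope w a (t + - (w / 2)) * (t - (t + - (w / 2))).
    have -> : t - (t + - (w / 2)) = w / 2 by ring.
    apply: ler_wpM2r; first lra.
    have c : w / 2 <= clip w (t + - (w / 2) - a).
      by rewrite /clip; case: ltP => ?; [lra|case: ltP => ?; lra].
    have := ler_wpM2l Lmu c.
    have tw : w / 2 <= t + - (w / 2) by lra.
    have := ler_wpM2l (ltW mu0) tw.
    rewrite /huber_slope; lra.
  lra.
have drop_left t : t < a - w ->
    huber_potential w a (t + w / 2) + 12 <= huber_potential w a t.
  move=> ht; have /andP[lo _] := bnd t (t + w / 2).
  have := muw (t - (t + w / 2)).
  have : 3 * Num.sqrt L * (w / 2) <= huber_slope w a (t + w / 2) * (t - (t + w / 2)).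
    have -> : t - (t + w / 2) = - (w / 2) by ring.
    rewrite mulrN -mulNr; apply: ler_wpM2r; first lra.
    have c : clip w (t + w / 2 - a) <= - (w / 2).
      by rewrite /clip; case: ltP => ?; [lra|case: ltP => ?; lra].
    have := ler_wpM2l Lmu c.
    have tw : t + w / 2 <= a - w / 2 by lra.
    have := ler_wpM2l (ltW mu0) tw.
    rewrite /huber_slope; lra.
  lra.
have T1 := line_mass_tail_le mphi (measurable_below (a - w)) drop_left.
have T2 := line_mass_tail_le mphi (measurable_above (a + w)) drop_right.
have aww : a - w <= a + w by lra.
have := line_mass_split mphi aww.
move: T1 T2.
have A1J := line_mass_le mphi (measurable_below (a - w)).
have A2J := line_mass_le mphi (measurable_above (a + w)).
have A3J := line_mass_le mphi (measurable_between (a - w) (a + w)).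
set J := line_mass _ setT in J0 Jfin A1J A2J A3J *.
set A1 := line_mass _ _ in A1J *; set A2 := line_mass _ _ in A2J *.
set A3 := line_mass _ _ in A3J *.
have JE := fineK Jfin.
have fin A : (0 <= A)%E -> (A <= J)%E -> A = (fine A)%:E.
  by move=> A0 AJ; rewrite fineK// ge0_fin_numE//; apply: le_lt_trans AJ _; rewrite ltey_eq Jfin.
have J0' : 0 < fine J by rewrite fine_gt0// J0 ltey_eq Jfin.
rewrite (fin A1) ?line_mass_ge0// (fin A2) ?line_mass_ge0// (fin A3) ?line_mass_ge0//.
rewrite -JE /= -!EFinM -!EFinD !lee_fin => T1 T2 [sumJ].
rewrite [_^-1 * _]mulrC ler_pdivlMr//; lra.
Qed.

End huber.

(** * Oracles depending on the current query *)

Section total_variation.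
Context {R : realType}.

Lemma tv_dist_real d (T : measurableType d) (P Q : set T -> \bar R)
    (eps q : R) (D : set T) : (tv_dist P Q <= eps%:E)%E -> measurable D ->
  (0 <= P D)%E -> Q D = q%:E ->
  exists2 p, P D = p%:E & `|p - q| <= eps.
Proof.
move=> tv mD P0 QD.
have : (`|P D - Q D| <= eps%:E)%E.
  by apply: le_trans tv; apply: ereal_sup_ubound; exists D.
rewrite QD; case: (P D) P0 => [p _|//|//].
by rewrite -EFinB abse_EFin lee_fin; exists p.
Qed.

Lemma gibbs_lift_real (L mu : R) phi dphi n (A : set R) : 0 < mu -> mu <= L ->
  line_potential L mu phi dphi -> measurable A ->
  exists2 q, gibbs (lift_potential mu phi)
    [set x : 'rV[R]_n.+1 | A (x ord0 ord0)] = q%:E & 0 <= q.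
Proof.
move=> mu0 muL hphi mA; rewrite (gibbs_lift n mu0 muL hphi mA).
have [J0 Jfin] := line_mass_gt0 mu0 muL hphi.
have mphi : measurable_fun [set: R] phi.
  by apply: continuous_measurable_fun; exact: (line_continuous mu0 hphi).
have Afin : line_mass phi A \is a fin_num.
  rewrite ge0_fin_numE ?line_mass_ge0//.
  by apply: le_lt_trans (line_mass_le mphi mA) _; rewrite ltey_eq Jfin.
exists ((fine (line_mass phi setT))^-1 * fine (line_mass phi A)).
  by rewrite EFinM fineK.
by rewrite mulr_ge0 ?invr_ge0 ?fine_ge0// ?line_mass_ge0// ltW.
Qed.

End total_variation.

Section query_oracles.
Context {R : realType} {d : nat}.
Local Notation V := 'rV[R]_d.
Variable A : @algorithm R d.
Local Notation round n := (n.-tuple (rand A * V * V) * (rand A * V))%type.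

Lemma measurable_query n : measurable_fun setT (fun z : round n => z.2.2).
Proof. by apply: measurableT_comp => //; exact: measurableT_comp. Qed.

Definition exact_oracle (g : V -> V) (mg : measurable_fun [set: V] g) : oracle A :=
  fun n => kdirac (measurableT_comp mg (@measurable_query n)).

Lemma exact_oracleE (g : V -> V) (mg : measurable_fun [set: V] g) k z B :
  exact_oracle mg k z B = dirac (g z.2.2) B :> \bar R.
Proof. by []. Qed.

Definition mix_oracle (p : R) (p0 : 0 <= p) (p1 : p <= 1) (u v : V -> V)
    (mu : measurable_fun [set: V] u) (mv : measurable_fun [set: V] v) : oracle A :=
  fun n => kmix (exact_oracle mu n) (exact_oracle mv n) p0 p1.

Lemma measurable_enorm_sqr (a : V) :
  measurable_fun [set: V] (fun g => enorm (g - a) ^+ 2).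
Proof.
under eq_fun do rewrite enorm_sqr.
apply: measurable_sum => i; apply: measurable_funX.
under eq_fun do rewrite !mxE.
by apply: measurable_funB => //; exact: measurable_coord.
Qed.

Lemma mix_oracle_admissible (p : R) (p0 : 0 <= p) (p1 : p <= 1) (u v : V -> V)
    (mu : measurable_fun [set: V] u) (mv : measurable_fun [set: V] v)
    (f : V -> R) (sigma2 : R) :
  (forall x, p *: u x + (1 - p) *: v x = gradient f x) ->
  (forall x, p * enorm (u x - gradient f x) ^+ 2
    + (1 - p) * enorm (v x - gradient f x) ^+ 2 <= sigma2) ->
  admissible (mix_oracle p0 p1 mu mv) f sigma2.
Proof.
move=> mean var n; apply: aeW => z; split=> [i|].
  rewrite (integral_kmix_kdirac _ _ _ _ _ (@measurable_coord _ _ d i)).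
  by rewrite -mean !mxE.
rewrite (integral_kmix_kdirac _ _ _ _ _ (measurable_enorm_sqr _)) lee_fin.
exact: var.
Qed.

Lemma exact_oracle_admissible (g : V -> V) (mg : measurable_fun [set: V] g)
    (f : V -> R) (sigma2 : R) : gradient f = g -> 0 <= sigma2 ->
  admissible (exact_oracle mg) f sigma2.
Proof.
move=> fg s0 n; apply: aeW => z; split=> [i|].
  rewrite integral_dirac//.
    by rewrite diracT mul1e fg.
  by apply/measurable_EFinP; exact: measurable_coord.
rewrite integral_dirac//.
  rewrite diracT mul1e fg subrr lee_fin enorm_sqr big1// => i _.
  by rewrite mxE expr0n.
by apply/measurable_EFinP; exact: measurable_enorm_sqr.
Qed.

Lemma running_stop0 : @stop R d A 0 [tuple] ->
  forall n t, ~ @running R d A n.+1 t.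
Proof.
move=> s0; elim=> [|n IHn] t /= [].
  by move=> _; apply; rewrite (tuple0 [tuple of behead t]).
by move=> /IHn.
Qed.

(** The decision before any query is deterministic: either [T = 0] surely, which a positive
    expectation excludes, or [T >= 1] surely. *)
Lemma expected_queries_ge1 (orc : oracle A) : terminates orc ->
  (0 < expected_queries orc)%E -> (1 <= expected_queries orc)%E.
Proof.
move=> term; have [s0|ns0] := pselect (@stop R d A 0 [tuple]).
  rewrite /expected_queries eseries0 ?ltxx// => -[|n] _ _; first by rewrite mul0e.
  rewrite [X in law _ _ X](_ : _ = set0) ?measure0 ?mule0//.
  by apply/seteqP; split => // h [/(running_stop0 s0)].
move=> _; rewrite -term; apply: lee_nneseries => [n _ _|[|n] _].
- exact: measure_ge0.
- rewrite mul0e [X in law _ _ X](_ : _ = set0) ?measure0//.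
  by apply/seteqP; split => // h [_]; rewrite (tuple0 (transcript h)).
- rewrite -[leLHS]mul1e; apply: lee_wpmul2r => //.
  by rewrite lee_fin ler1n.
Qed.

(** Bernoulli's inequality [(1 - p)^n + p n >= 1], averaged over [T]. *)
Lemma bernoulli_stopped_mass (orc : oracle A) (p : R) : terminates orc ->
  0 <= p -> p <= 1 ->
  (1 <= \sum_(0 <= n <oo) ((1 - p) ^+ n)%:E * law orc n (@stops_at R d A n)
    + p%:E * expected_queries orc)%E.
Proof.
move=> term p0 p1; have q0 : 0 <= 1 - p by rewrite subr_ge0.
have bern n : 1 <= (1 - p) ^+ n + p * n%:R.
  elim: n => [|n IHn]; first by rewrite expr0 mulr0 addr0.
  have e1 : (1 - p) ^+ n <= 1 by rewrite exprn_ile1// gerBl.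
  have pe : p * (1 - p) ^+ n <= p * 1 by rewrite ler_wpM2l.
  by rewrite exprS -natr1; lra.
rewrite /expected_queries -nneseriesZl => [|n _]; last by rewrite mule_ge0// lee_fin.
rewrite -nneseriesD => [|n _ _|n _ _]; last 2 first.
- by rewrite mule_ge0// lee_fin exprn_ge0.
- by rewrite !mule_ge0// lee_fin.
rewrite -term; apply: lee_nneseries => [n _ _|n _]; first exact: measure_ge0.
rewrite muleA -EFinM -ge0_muleDl; last 2 first.
- by rewrite lee_fin exprn_ge0.
- by rewrite lee_fin mulr_ge0.
rewrite -EFinD -[leLHS]mul1e; apply: lee_wpmul2r => //.
by rewrite lee_fin.
Qed.

End query_oracles.

(** * Lower bounds *)

Section lower_bounds.
Context {R : realType} {n : nat}.
Local Notation V := 'rV[R]_n.+1.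
Variables (L mu sigma2 eps : R).
Hypotheses (mu0 : 0 < mu) (muL : mu <= L) (s20 : 0 <= sigma2).
Hypotheses (eps0 : 0 < eps) (eps10 : eps <= 1 / 10).
Variable A : @algorithm R n.+1.
Hypothesis vA : valid L mu sigma2 eps A.

Lemma measurable_lift_gradient (dphi : R -> R) : measurable_fun [set: R] dphi ->
  measurable_fun [set: V] (lift_gradient mu dphi).
Proof.
move=> md; apply: measurable_fun_rV => i.
have m0 := @measurable_coord _ R n.+1 ord0.
under eq_fun do rewrite !mxE.
apply: measurable_funD.
  by apply: measurable_funM => //; exact: measurable_coord.
apply: measurable_funM => //; apply: measurable_funB.
  exact: (measurableT_comp md m0).
exact: measurable_funM.
Qed.

Lemma expected_queries_le_worst f (orc : oracle A) : potential_class L mu f ->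
  admissible orc f sigma2 ->
  (expected_queries orc <= worst_case_queries L mu sigma2 A)%E.
Proof. by move=> hf ho; apply: ereal_sup_ubound; exists f, orc. Qed.

(** * Shifted quadratics and the noise bound *)

Definition center_slope (a t : R) : R := mu * (t - a).

Lemma measurable_center_slope a : measurable_fun [set: R] (center_slope a).
Proof. by apply: measurable_funM => //; exact: measurable_funB. Qed.

Definition center_gradient a := lift_gradient mu (center_slope a) : V -> V.

Lemma measurable_center_gradient a : measurable_fun [set: V] (center_gradient a).
Proof. by apply: measurable_lift_gradient; exact: measurable_center_slope. Qed.

Lemma center_gradientE a x :
  center_gradient a x = mu *: x - (mu * a) *: delta_mx ord0 ord0.
Proof.
rewrite /center_gradient /lift_gradient /center_slope.
have -> : mu * (x ord0 ord0 - a) - mu * x ord0 ord0 = - (mu * a) by ring.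
by rewrite scaleNr.
Qed.

Definition center_oracle : oracle A := exact_oracle A (measurable_center_gradient 0).

Lemma center_gradient_lift a : `|a| <= (Num.sqrt mu)^-1 ->
  gradient (lift_potential mu (shifted_square mu a)) = center_gradient a.
Proof.
move=> aM; apply/funext => x.
exact: (gradient_lift mu0 muL (line_potential_square muL aM)).
Qed.

Lemma center_class a : `|a| <= (Num.sqrt mu)^-1 ->
  potential_class L mu (lift_potential mu (shifted_square mu a) : V -> R).
Proof.
by move=> aM; exact: (lift_potential_class mu0 muL (line_potential_square muL aM)).
Qed.

Lemma center0_le : `|0 : R| <= (Num.sqrt mu)^-1.
Proof. by rewrite normr0 invr_ge0 sqrtr_ge0. Qed.

Lemma center_oracle_admissible :
  admissible center_oracle (lift_potential mu (shifted_square mu 0)) sigma2.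
Proof.
apply: exact_oracle_admissible => //; exact: (center_gradient_lift center0_le).
Qed.

(* Unbiased because p * (a / p) = a; replies depend on a with probability p only. *)
Definition rare_oracle (a p : R) (p0 : 0 <= p) (p1 : p <= 1) : oracle A :=
  mix_oracle A p0 p1 (measurable_center_gradient (a / p))
    (measurable_center_gradient 0).

Lemma rare_oracle_admissible a p (p0 : 0 <= p) (p1 : p <= 1) :
  `|a| <= (Num.sqrt mu)^-1 -> 0 < p -> (mu * a) ^+ 2 * (1 - p) <= p * sigma2 ->
  admissible (rare_oracle a p0 p1) (lift_potential mu (shifted_square mu a)) sigma2.
Proof.
move=> aM pp var.
apply: mix_oracle_admissible; rewrite (center_gradient_lift aM) => x.
  apply/rowP => i; rewrite !center_gradientE !mxE.
  by field; rewrite gt_eqF.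
have e1 : center_gradient (a / p) x - center_gradient a x =
    (mu * a - mu * (a / p)) *: delta_mx ord0 ord0.
  by rewrite !center_gradientE opprD opprK addrACA subrr add0r addrC scalerBl.
have e2 : center_gradient 0 x - center_gradient a x =
    (mu * a) *: delta_mx ord0 ord0.
  by rewrite !center_gradientE mulr0 scale0r subr0 opprD opprK addrA subrr add0r.
rewrite e1 e2 !enorm_scale_delta.
(* The exact variance of the two-valued reply, to be compared with the hypothesis divided by [p]. *)
have -> : p * (mu * a - mu * (a / p)) ^+ 2 + (1 - p) * (mu * a) ^+ 2 =
    (mu * a) ^+ 2 * (1 - p) / p.
  by field; rewrite gt_eqF.
by rewrite ler_pdivrMr// [sigma2 * p]mulrC.
Qed.

(** The minorant does not depend on [a], so one reference run serves both signs of the shift. *)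
Lemma rare_oracle_dominates a p (p0 : 0 <= p) (p1 : p <= 1) k z B :
  measurable B -> ((1 - p)%:E * center_oracle k z B <= rare_oracle a p0 p1 k z B)%E.
Proof.
move=> mB; rewrite /rare_oracle /mix_oracle kmixE leeDr//.
by rewrite mule_ge0// lee_fin.
Qed.

(** For the shifts [b] and [- b] with [b = 5 eps / sqrt mu], the targets give their wrong
    half-spaces masses summing to at most [1 - 3.05 eps], so the outputs give at most
    [1 - 1.05 eps]. This bounds the expectation of [(1 - p)^T], and Bernoulli's inequality turns the
    deficit into queries. *)
Lemma two_point_bound (p : R) : 0 < p -> p <= 1 ->
  25%:R * mu * eps ^+ 2 * (1 - p) <= p * sigma2 ->
  ((105%:R / 100%:R * eps)%:E <= p%:E * expected_queries center_oracle)%E.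
Proof.
move=> pp p1 var; have p0 := ltW pp.
have s0 : 0 < Num.sqrt mu by rewrite sqrtr_gt0.
pose b := 5 * eps / Num.sqrt mu.
have b0 : 0 < b by rewrite divr_gt0// mulr_gt0.
have bmu : b * Num.sqrt mu = 5 * eps by rewrite divfK// gt_eqF.
clearbody b.
have bM : `|b| <= (Num.sqrt mu)^-1.
  have e5 : 5 * eps <= 1 by have := eps10; lra.
  by rewrite gtr0_norm// -div1r ler_pdivlMr// bmu.
have bM' : `|- b| <= (Num.sqrt mu)^-1 by rewrite normrN.
have mub : (mu * b) ^+ 2 = 25%:R * mu * eps ^+ 2.
  rewrite exprMn -{1}(sqr_sqrtr (ltW mu0)) -exprMn.
  have -> : Num.sqrt mu ^+ 2 * b = Num.sqrt mu * (b * Num.sqrt mu) by ring.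
  by rewrite bmu exprMn sqr_sqrtr ?ltW//; ring.
have adp : admissible (rare_oracle b p0 p1) (lift_potential mu (shifted_square mu b)) sigma2.
  by apply: rare_oracle_admissible => //; rewrite mub.
have adm : admissible (rare_oracle (- b) p0 p1) (lift_potential mu (shifted_square mu (- b))) sigma2.
  by apply: rare_oracle_admissible => //; rewrite mulrN sqrrN mub.
have [_ tvp] := vA (center_class bM) adp.
have [_ tvm] := vA (center_class bM') adm.
have [term _] := vA (center_class center0_le) center_oracle_admissible.
pose D := [set x : V | (x ord0 ord0 < 0)%R].
have mD : measurable D by exact: (measurable_slab (measurable_below 0)).
have DC : ~` D = [set x : V | [set t : R | (0 <= t)%R] (x ord0 ord0)].
  by apply/seteqP; split => x /=; [move/negP; rewrite -leNgt|rewrite leNgt => /negP].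
have hp := line_potential_square muL bM.
have hm := line_potential_square muL bM'.
have [qp qpE qp0] := gibbs_lift_real n mu0 muL hp (measurable_below 0).
have [qm qmE qm0] := gibbs_lift_real n mu0 muL hm (measurable_above 0).
rewrite -DC in qmE.
have bhalf : b * Num.sqrt mu <= 1 / 2.
  by move: eps10 bmu; set s := Num.sqrt mu; lra.
have := gibbs_square_halfspaces mu0 n muL b0 bhalf.
rewrite -/D qpE qmE -EFinD lee_fin bmu => qq.
have out0 (orc : oracle A) B : (0 <= output_law orc B)%E.
  by rewrite output_lawE; apply: nneseries_ge0 => k _ _; exact: stop_output_ge0.
have [op opE opq] := tv_dist_real tvp mD (out0 _ _) qpE.
have [om omE omq] := tv_dist_real tvm (measurableC mD) (out0 _ _) qmE.
have q0 : 0 <= 1 - p by rewrite subr_ge0.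
have := @stopped_mass_le _ _ A center_oracle (rare_oracle b p0 p1)
  (rare_oracle (- b) p0 p1) (1 - p) D q0 mD
  (@rare_oracle_dominates b p p0 p1) (@rare_oracle_dominates (- b) p p0 p1).
rewrite opE omE -EFinD => mass.
have := bernoulli_stopped_mass term p0 p1.
move=> /le_trans => /(_ _ (leeD mass (lexx _))).
move: opq omq; rewrite !ler_norml => /andP[_ h1] /andP[_ h2] h3.
rewrite -(leeD2lE (x := (op + om)%:E))//.
apply: le_trans h3; rewrite -EFinD lee_fin; lra.
Qed.

(** With [p = 1] the variance condition holds for every [sigma2]; the resulting positive expectation
    is then at least 1. *)
Lemma worst_case_ge1 : (1 <= worst_case_queries L mu sigma2 A)%E.
Proof.
have [term _] := vA (center_class center0_le) center_oracle_admissible.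
apply: le_trans (expected_queries_le_worst (center_class center0_le)
  center_oracle_admissible).
apply: expected_queries_ge1 => //; rewrite -[X in (0 < X)%E]mul1e.
apply: (@lt_le_trans _ _ (105%:R / 100%:R * eps)%:E); first by rewrite lte_fin mulr_gt0.
by apply: two_point_bound => //; rewrite subrr mulr0 mul1r.
Qed.

Lemma worst_case_ge_noise :
  ((sigma2 / (mu * eps) / 24%:R)%:E <= worst_case_queries L mu sigma2 A)%E.
Proof.
set X := sigma2 / (mu * eps).
have [X24|X24] := leP X 24%:R.
  apply: le_trans worst_case_ge1; rewrite lee_fin; lra.
have sE : sigma2 = X * (mu * eps) by rewrite divfK// gt_eqF// mulr_gt0.
have X0 : 0 < X by lra.
(* Chosen so that [p * sigma2 = 25 mu eps^2]. The cost is then at least [1.05 X / 25], which exceeds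
   [X / 24]; [p <= 1] holds because [X > 24]. *)
pose p := 25%:R * eps / X.
have p0 : 0 < p by rewrite divr_gt0// mulr_gt0.
have e25 : 25%:R * eps <= X by move: eps10 X24; lra.
have p1 : p <= 1 by rewrite ler_pdivrMr// mul1r.
have var : 25%:R * mu * eps ^+ 2 * (1 - p) <= p * sigma2.
  have -> : p * sigma2 = 25%:R * mu * eps ^+ 2.
    by rewrite sE /p; field; rewrite gt_eqF.
  by rewrite ler_piMr ?gerBl ?(ltW p0)// !mulr_ge0// ?exprn_ge0// ltW.
have := two_point_bound p0 p1 var.
have := expected_queries_le_worst (center_class center0_le) center_oracle_admissible.
set E := expected_queries _ => EW pE.
apply: le_trans EW; rewrite -(lee_pmul2l (x := p%:E))// ?lte_fin//.
apply: le_trans pE; rewrite -EFinM lee_fin.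
have -> : p * (X / 24%:R) = 25%:R / 24%:R * eps by rewrite /p; field; rewrite gt_eqF.
by rewrite ler_pM2r//; lra.
Qed.

(** * The condition-number bound *)

Definition window_width : R := 8 / Num.sqrt L.
Local Notation w := window_width.

(** With spacing [2 w] consecutive windows abut, and being half-open they are disjoint. *)
Definition window_center (j : nat) : R := 2 * w * j%:R.

Definition window (j : nat) : set V :=
  [set x | (window_center j - w <= x ord0 ord0 < window_center j + w)%R].

Definition window_potential j : V -> R :=
  lift_potential mu (huber_potential L mu w (window_center j)).

Lemma window_width_gt0 : 0 < w.
Proof. by rewrite divr_gt0// sqrtr_gt0; exact: lt_le_trans muL. Qed.

Lemma measurable_window j : measurable (window j).
Proof. exact: (measurable_slab (measurable_between _ _)). Qed.

Lemma trivIset_window : trivIset setT window.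
Proof.
have w0 := window_width_gt0.
have sep i j (x : V) : (i < j)%N -> window i x -> window j x -> False.
  move=> ij /andP[_ h1] /andP[h2 _].
  have : i%:R + 1 <= j%:R :> R by rewrite natr1 ler_nat.
  move=> h; have hw : 2 * w * (i%:R + 1) <= 2 * w * j%:R.
    by rewrite ler_wpM2l// mulr_ge0// ltW.
  move: h1 h2 hw; rewrite /window_center; lra.
apply/trivIsetP => i j _ _ ij; apply/seteqP; split => // x [xi xj].
by case: (ltngtP i j) ij => // [/sep|/sep]; [move=> /(_ x xi xj)|move=> /(_ x xj xi)].
Qed.

(** The inner slope of all [K] potentials at once: at most one term is nonzero, and the formula does
    not know which window is the true one. *)
Definition local_slope (K : nat) (t : R) : R :=
  mu * t + (L - mu) * \sum_(j < K)
    if window_center j - w <= t < window_center j + w then t - window_center j else 0.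

Lemma local_slopeE K j t : (j < K)%N ->
  window_center j - w <= t < window_center j + w ->
  local_slope K t = huber_slope L mu w (window_center j) t.
Proof.
move=> jK tj; rewrite (huber_slope_mid _ _ tj) /local_slope (bigD1 (Ordinal jK))//=.
rewrite tj big1 ?addr0// => i ij; case: ifP => // ti; exfalso.
have /trivIsetP/(_ i j Logic.I Logic.I) := trivIset_window.
have -> : (i : nat) != j by apply: contraNneq ij => ij; exact/eqP/val_inj.
(* Disjointness concerns windows of vectors, so [t] is placed on the first axis. *)
move=> /(_ isT)/seteqP[/(_ (t *: delta_mx ord0 ord0)) + _]; apply.
by rewrite /window /= !mxE !eqxx mulr1.
Qed.

Lemma measurable_local_slope K : measurable_fun [set: R] (local_slope K).
Proof.
apply: measurable_funD; first exact: measurable_funM.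
apply: measurable_funM => //; apply: measurable_sum => j.
apply: measurable_fun_ifT => //; last exact: measurable_funB.
by apply: measurable_and; [exact: measurable_fun_ler|exact: measurable_fun_ltr].
Qed.

Definition left_slope (t : R) : R := mu * t - (L - mu) * w.
Definition right_slope (t : R) : R := mu * t + (L - mu) * w.

Lemma measurable_left_slope : measurable_fun [set: R] left_slope.
Proof. by apply: measurable_funB => //; exact: measurable_funM. Qed.

Lemma measurable_right_slope : measurable_fun [set: R] right_slope.
Proof. by apply: measurable_funD => //; exact: measurable_funM. Qed.

Lemma measurable_huber_slope j :
  measurable_fun [set: R] (huber_slope L mu w (window_center j)).
Proof.
apply: continuous_measurable_fun; apply: continuous_huber_slope.
exact: ltW window_width_gt0.
Qed.

Definition window_oracle j : oracle A :=
  exact_oracle A (measurable_lift_gradient (measurable_huber_slope j)).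

Let third0 : 0 <= 3^-1 :> R. Proof. by []. Qed.
Let third1 : 3^-1 <= 1 :> R. Proof. by rewrite invf_le1 ?ler1n. Qed.
Let half0 : 0 <= 2^-1 :> R. Proof. by []. Qed.
Let half1 : 2^-1 <= 1 :> R. Proof. by rewrite invf_le1 ?ler1n. Qed.

(* Guesses whether the query lies to the left of, to the right of, or inside the
   window; inside, the window is determined by the query. *)
Definition guessing_oracle K : oracle A := fun k =>
  kmix (exact_oracle A (measurable_lift_gradient measurable_left_slope) k)
    (mix_oracle A half0 half1 (measurable_lift_gradient measurable_right_slope)
      (measurable_lift_gradient (measurable_local_slope K)) k) third0 third1.

(** The weights [1 / 3] and [2 / 3 * 1 / 2] give each of the three replies probability [1 / 3]; the
    position of the query decides which one is exact for window [j]. *)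
Lemma guessing_oracle_dominates K j k z B : (j < K)%N -> measurable B ->
  ((3^-1)%:E * window_oracle j k z B <= guessing_oracle K k z B)%E.
Proof.
move=> jK mB; rewrite /guessing_oracle kmixE [mix_oracle _ _ _ _ _ _ _ _]kmixE.
have -> : (1 - 3^-1 : R) = 2 * 3^-1 by field.
have -> : (1 - 2^-1 : R) = 2^-1 by field.
have lg0 dphi psi (x : V) : dphi (x ord0 ord0) = psi (x ord0 ord0) ->
    lift_gradient mu dphi x = lift_gradient mu psi x.
  by rewrite /lift_gradient => ->.
have w0 := ltW window_width_gt0.
set a := exact_oracle _ _ _ z B; set b := exact_oracle _ _ _ z B.
set c := exact_oracle _ _ _ z B.
have a0 : (0 <= a)%E by exact: measure_ge0.
have b0 : (0 <= b)%E by exact: measure_ge0.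
have c0 : (0 <= c)%E by exact: measure_ge0.
have -> : ((2 / 3)%:E * ((2^-1)%:E * b + (2^-1)%:E * c) =
    (3^-1)%:E * b + (3^-1)%:E * c)%E.
  rewrite ge0_muleDr ?mule_ge0//.
  rewrite [X in (X + _)%E]muleA [X in (_ + X)%E]muleA -!EFinM.
  by have -> : 2 / 3 * 2^-1 = 3^-1 :> R by field.
have third (x : \bar R) : (0 <= x)%E -> (0 <= (3^-1)%:E * x)%E by move=> x0; rewrite mule_ge0.
have [tl|tl] := ltP (z.2.2 ord0 ord0) (window_center j - w).
  have -> : window_oracle j k z B = a.
    rewrite /window_oracle /a !exact_oracleE (lg0 _ left_slope)//.
    by rewrite huber_slope_left.
  by rewrite leeDl// adde_ge0// third.
have [tr|tr] := leP (window_center j + w) (z.2.2 ord0 ord0).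
  have -> : window_oracle j k z B = b.
    rewrite /window_oracle /b !exact_oracleE (lg0 _ right_slope)//.
    by rewrite huber_slope_right.
  by rewrite addeCA leeDl// adde_ge0// third.
have -> : window_oracle j k z B = c.
  rewrite /window_oracle /c !exact_oracleE (lg0 _ (local_slope K))//.
  by rewrite (local_slopeE jK)// tl tr.
by rewrite addeA leeDr// adde_ge0// third.
Qed.

(** The hypothesis fits [K = 3 ^ r.+1] centers with spacing [16 / sqrt L] into [[0, 1 / sqrt mu]].
    Each window gets output mass at least [5 / 6 - 1 / 10 = 11 / 15]. As [3 ^ r = K / 3], dividing
    [packing_bound] by [K] leaves [(11 / 15 - 1 / 3) r = 2 r / 5]. *)
Lemma worst_case_ge_rounds (r : nat) :
  16%:R * 3 ^+ r.+1 <= Num.sqrt L / Num.sqrt mu ->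
  ((2 / 5 * r%:R)%:E <= worst_case_queries L mu sigma2 A)%E.
Proof.
move=> hr; set W := worst_case_queries _ _ _ _; set K := (3 ^ r.+1)%N.
have l0 : 0 < Num.sqrt L by rewrite sqrtr_gt0; exact: lt_le_trans muL.
have s0 : 0 < Num.sqrt mu by rewrite sqrtr_gt0.
have w0 := window_width_gt0.
have center_bounds j : (j < K)%N ->
    0 <= window_center j /\ window_center j <= (Num.sqrt mu)^-1.
  move=> jK; split; first by rewrite !mulr_ge0// ltW.
  have jr : j%:R <= 3 ^+ r.+1 :> R by rewrite -natrX ler_nat ltnW.
  have : 16%:R * j%:R <= Num.sqrt L / Num.sqrt mu by apply: le_trans hr; rewrite ler_pM2l.
  rewrite -(ler_pM2l (x := (Num.sqrt L)^-1)) ?invr_gt0// mulKf ?gt_eqF//.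
  by apply: le_trans; rewrite /window_center /window_width le_eqVlt; apply/orP; left; apply/eqP; field; rewrite gt_eqF.
have K0 : 0 < K%:R :> R by rewrite ltr0n expn_gt0.
have W1 : (1 <= W)%E := worst_case_ge1.
case EW : W W1 => [x| |] W1; [|exact: leey|by []].
move: W1; rewrite lee_fin => x1.
have facts j : (j < K)%N ->
    ((11%:R / 15%:R)%:E <= output_law (window_oracle j) (window j))%E /\
    (expected_queries (window_oracle j) <= x%:E)%E.
  move=> jK; have [c0 c1] := center_bounds j jK.
  have [hphi gib] := gibbs_huber_window mu0 muL n c0 c1.
  have cls := lift_potential_class mu0 muL hphi n.
  have adm : admissible (window_oracle j) (window_potential j) sigma2.
    apply: exact_oracle_admissible => //; apply/funext => y.
    exact: (gradient_lift mu0 muL hphi).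
  have [_ tv] := vA cls adm.
  split; last by rewrite -EW; exact: expected_queries_le_worst cls adm.
  have [q qE q0] := gibbs_lift_real n mu0 muL hphi
    (measurable_between (window_center j - w) (window_center j + w)).
  have out0 : (0 <= output_law (window_oracle j) (window j))%E.
    by rewrite output_lawE; apply: nneseries_ge0 => k _ _; exact: stop_output_ge0.
  have [p pE pq] := tv_dist_real tv (measurable_window j) out0 qE.
  move: gib; rewrite pE -/w qE !lee_fin => gib.
  by move: pq eps10 gib; rewrite ler_norml => /andP[+ _]; lra.
have := @packing_bound _ _ A window_oracle (guessing_oracle K) K r window
  measurable_window trivIset_window
  (fun j jK k z B mB => @guessing_oracle_dominates K j k z B jK mB).
have lowE : (\sum_(j < K) (11%:R / 15%:R)%:E <=
    \sum_(j < K) output_law (window_oracle j) (window j))%E.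
  by apply: lee_sum => j _; have [] := facts j (ltn_ord j).
have upE : (\sum_(j < K) expected_queries (window_oracle j) <=
    \sum_(j < K) x%:E)%E.
  by apply: lee_sum => j _; have [] := facts j (ltn_ord j).
have sumK (c : R) : (\sum_(j < K) c%:E = (c * K%:R)%:E)%E.
  by rewrite sumEFin sumr_const card_ord mulr_natr.
rewrite !sumK in lowE upE.
have r0 : (0 <= r%:R%:E :> \bar R)%E by rewrite lee_fin.
move=> /(le_trans (lee_wpmul2l r0 lowE)) /le_trans => /(_ _ (leeD (lexx _) upE)).
rewrite -EFinM -EFinD lee_fin.
have -> : 3 ^+ r = K%:R / 3 :> R by rewrite /K natrX exprS; field.
move=> bound; have : r%:R * (11%:R / 15%:R) * K%:R <= (r%:R / 3 + x) * K%:R.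
  rewrite -mulrA; apply: le_trans bound _; clearbody K.
  by rewrite le_eqVlt; apply/orP; left; apply/eqP; field.
rewrite ler_pM2r// lee_fin; lra.
Qed.

Lemma worst_case_ge_log :
  ((ln (1 + L / mu) / 37%:R)%:E <= worst_case_queries L mu sigma2 A)%E.
Proof.
have rounds := worst_case_ge_rounds; have W1 := worst_case_ge1.
case EW : (worst_case_queries _ _ _ _) rounds W1 => [x| |] rounds W1;
  [|exact: leey|by []].
move: W1; rewrite !lee_fin => x1.
pose s := Num.sqrt L / Num.sqrt mu.
have s0 : 0 < Num.sqrt mu by rewrite sqrtr_gt0.
have L0 : 0 < L by exact: lt_le_trans muL.
have s1 : 1 <= s by rewrite ler_pdivlMr// mul1r ler_sqrt// ltW.
have s2 : s ^+ 2 = L / mu by rewrite exprMn exprVn !sqr_sqrtr ?ltW.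
have exM : exists m, s < 3 ^+ m.
  exists (Num.truncn s).+1; apply: lt_trans (truncnS_gt s) _.
  by rewrite -natrX ltr_nat ltn_expl.
case: (ex_minnP exM) => m sm minm.
(* For [m > 5] take [r = m - 5]: by minimality of [m], [16 * 3 ^ (m - 4) <= 3 ^ (m - 1) <= s].
   Otherwise the left side is at most 0. *)
have m2 : 2 / 5 * (m%:R - 5) <= x.
  have [m5|m5] := leqP m 5.
    have : m%:R <= 5 :> R by rewrite ler_nat.
    by move: x1; lra.
  have -> : m%:R - 5 = (m - 5)%:R :> R by rewrite natrB// ltnW.
  rewrite -lee_fin; apply: rounds; rewrite -/s.
  have m1 : 3 ^+ m.-1 <= s.
    rewrite leNgt; apply/negP => /minm; rewrite leqNgt prednK ?leqnn//.
    by apply: leq_ltn_trans m5.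
  apply: le_trans m1; have -> : (m.-1 = (m - 5).+1 + 3)%N.
    by case: (m) m5 => [|[|[|[|[|[|k]]]]]] //= _; rewrite !subSS subn0 addn3.
  by rewrite exprD mulrC ler_pM2l ?exprn_gt0//; lra.
(* Both summands are at most [s ^+ 2], hence at most [3 ^ (2 m)]. *)
have kle : 1 + L / mu <= 3 ^+ (2 * m + 1).
  have : s ^+ 2 <= (3 ^+ m) ^+ 2 by rewrite lerXn2r ?nnegrE//; lra.
  have : 1 <= s ^+ 2 by rewrite expr_ge1//; lra.
  rewrite s2 exprD mulnC exprM expr1; lra.
have lnle : ln (1 + L / mu) <= (2 * m%:R + 1) * 2.
  have k0 : 0 < 1 + L / mu by rewrite ltr_wpDr// divr_ge0// ltW.
  apply: (@le_trans _ _ (ln (3 ^+ (2 * m + 1)))).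
    by rewrite ler_ln// posrE.
  have ln3 : ln (3 : R) <= 2.
    have -> : 3 = 1 + 2 :> R by ring.
    by apply: le_ln1Dx; lra.
  rewrite lnXn// -[_ *+ (2 * m + 1)]mulr_natl natrD natrM.
  by apply: ler_wpM2l; rewrite // addr_ge0// mulr_ge0.
(* The logarithm is at most [4 m + 2], and [m <= 5 x / 2 + 5], so it is at most [10 x + 22 <= 32 x]
   since [x >= 1]. *)
rewrite ler_pdivrMr//; move: lnle m2 x1; lra.
Qed.

End lower_bounds.

Unset Implicit Arguments.

Theorem theorem2p4 (R : realType) (d : nat) (L mu sigma2 eps : R) :
  (1 <= d)%N -> 0 < mu -> mu <= L -> 0 <= sigma2 -> 0 < eps -> eps <= 1 / 10 ->
  let kappa := L / mu in
  let X := sigma2 / (mu * eps) in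
  let S := 1 + ln (1 + kappa) + X in
  ((Num.max 1 (Num.max (X / 24) (S / 62)))%:E <=
     minimax_queries d L mu sigma2 eps)%E.
Proof.
case: d => [//|n] _ mu0 muL s20 eps0 eps10 /=.
apply: le_ereal_inf_tmp => _ [A [vA ->]].
have h1 := worst_case_ge1 mu0 muL s20 eps0 eps10 vA.
have hX := worst_case_ge_noise mu0 muL s20 eps0 eps10 vA.
have hl := worst_case_ge_log mu0 muL s20 eps0 eps10 vA.
move: h1 hX hl; case: (worst_case_queries _ _ _ _) => [x| |];
  [|by move=> *; exact: leey|by []].
rewrite !lee_fin => h1 hX hl.
(* The three summands of [S] are at most [x], [37 x] and [24 x], and [1 + 37 + 24 = 62]. *)
rewrite !ge_max h1 hX/=; move: h1 hX hl; lra.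
Qed.
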